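(* For every integer $n \geq 11$, $$\mathrm{ex}_{\mathcal{P}}(n,C_{5}) \leq \frac{12n-33}{5}.$$
   Context: Graphs are finite and simple. A graph is called $H$-free if it does not contain the graph $H$ as a subgraph (whether induced or not). $\mathrm{ex}_{\mathcal{P}}(n,H)$ denotes the maximum number of edges possible in a planar $H$-free graph on $n$ vertices. $C_{5}$ denotes the cycle of length $5$. *)

(* Defs.v *)
From mathcomp Require Import all_boot all_order all_algebra.
From mathcomp Require Import all_classical all_reals all_analysis.

Set Implicit Arguments.
Unset Strict Implicit.
Unset Printing Implicit Defensive.

Import Order.TTheory GRing.Theory Num.Theory.
Import numFieldNormedType.Exports.

Local Open Scope classical_set_scope.
Local Open Scope ring_scope.

(* A graph with vertex set T is given by its edge set E : {set {set T}}; the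
   vertices are all the elements of T, so isolated vertices are allowed. *)
Definition simple_graph (T : finType) (E : {set {set T}}) : Prop :=
  forall f : {set T}, f \in E -> #|f| = 2%N.

Definition contains (U T : finType) (H : {set {set U}}) (E : {set {set T}}) :
    Prop :=
  exists2 phi : U -> T, injective phi &
    forall f : {set U}, f \in H -> phi @: f \in E.

Definition is_free (U T : finType) (H : {set {set U}}) (E : {set {set T}}) :
    Prop :=
  ~ contains H E.

(* For 2 < k this is the cycle of length k, since ordS is the successor
   modulo k. *)
Definition cycle_graph (k : nat) : {set {set 'I_k}} :=
  [set [set i; ordS i]%SET | i : 'I_k]%SET.

(* R * R is the plane, with the product topology. *)
Definition is_arc (R : realType) (A : set (R * R)) (p q : R * R) : Prop :=
  exists g : R -> R * R,
    [/\ {within `[0, 1], continuous g}, set_inj `[0, 1] g,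
        g 0 = p, g 1 = q & A = g @` `[0, 1]].

(* An edge is drawn as a set of points, so the drawing does not depend on an
   orientation of the edge: arcs can be reversed. *)
Definition plane_drawing (R : realType) (T : finType) (E : {set {set T}})
    (pos : T -> R * R) (arc : {set T} -> set (R * R)) : Prop :=
  [/\ injective pos,
      forall x y : T, [set x; y]%SET \in E ->
        is_arc (arc [set x; y]%SET) (pos x) (pos y),
      forall (f : {set T}) (z : T), f \in E -> arc f (pos z) -> z \in f &
      forall f g : {set T}, f \in E -> g \in E -> f != g ->
        arc f `&` arc g `<=` [set pos z | z in [set` f :&: g]]].

Definition planar (R : realType) (T : finType) (E : {set {set T}}) : Prop :=
  exists (pos : T -> R * R) (arc : {set T} -> set (R * R)),
    plane_drawing E pos arc.

Definition ex_planar (R : realType) (n : nat) (U : finType)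
    (H : {set {set U}}) : nat :=
  \max_(E : {set {set 'I_n}} |
          `[< [/\ simple_graph E, planar R E & is_free H E] >]) #|E|.

(* Main.v *)
Require Import Defs.
From mathcomp Require Import all_boot.
From mathcomp Require Import boolp.
From mathcomp Require Import zify.

Set Implicit Arguments.
Unset Strict Implicit.
Unset Printing Implicit Defensive.

(** Topology enters only through an abstract dual of the graph: a finite set of
faces and, for each edge f, two faces l f and r f, such that the sets of edges
with all degrees even are exactly the edge cuts of the multigraph that joins
l f to r f for every edge f (Whitney's characterisation of planarity).

A plane drawing yields such a dual without the Jordan curve theorem. By
compactness, after replacing points of the plane by the cells of a fine grid,
every vertex becomes a box of cells and every edge a walk of cells between two
boxes, and the walks of two edges only meet in the box of a common end
([planar_grid_drawing]). Thus the graph is a minor of the grid graph. On the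
grid, an even set of edges bounds the set of the faces that have an odd number
of vertical edges of the set on their left, so the faces of the grid are a dual
([grid_exact], [grid_cut_closed]). Duals pass to minors: deleting an edge merges
its two faces, contracting it deletes it from the dual ([minor_has_dual]).

Let e, n and f be the numbers of edges, vertices and faces. Comparing the
numbers of edge sets, of vertex sets and of face sets gives e + 2 <= n + f
([euler_ineq]). The sides of a face form an even set of edges, of size 3, 4 or at
least 6, since an even set of size 5 is a pentagon. The claim 5e + 33 <= 12n
follows from Euler's inequality and 72n + 264f <= 184e, that is, from
72n <= sum over the faces of (92k - 264), k being the size of the face. This is
proved by discharging, in a two-connected graph of minimum degree 3. There, no
edge lies between a triangle and a quadrangle, and the triangular faces that
share edges come in pairs or in threes around a vertex: any other configuration
contains a pentagon, a vertex of degree 2, or the whole dual. Distributing the charge of the faces to the vertices leaves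
every vertex with at least 72, except for corners of such threes which have
degree 3 and are left with 36 ([vertex_charge]). A face of size k has at most
k - 6 of these corners, as they can be cut off one after the other: this gives
even sets of all the intermediate sizes, and 5 must not be one of them
([short_corners_le]). The excess charge of the long faces pays for these corners
([discharging_bound]).

Vertices of degree at most 2 and cut vertices are removed by induction
([planar_C5_bound]). The bound fails for small graphs, so the induction proves
that 5e + 33 <= 12n, or e + 3 <= 2n, or the graph behaves like a tree of k copies
of K4, with 3k + 1 vertices and 6k edges. When n is at least 11, each of the
other two cases implies the first one. *)

(** * Even sets of edges *)

Section EvenSets.
Variable T : finType.
Implicit Types (C D E : {set {set T}}) (f : {set T}) (x y z v : T).

Definition symdiff (U : finType) (A B : {set U}) : {set U} :=
  [set x | (x \in A) (+) (x \in B)].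

Lemma mem_symdiff (U : finType) (A B : {set U}) (x : U) :
  (x \in symdiff A B) = (x \in A) (+) (x \in B).
Proof. by rewrite inE. Qed.

Lemma odd_card_symdiff (U : finType) (A B : {set U}) :
  odd #|symdiff A B| = odd #|A| (+) odd #|B|.
Proof.
have cardE (X : {set U}) : odd #|X| = \big[addb/false]_x (x \in X).
  rewrite -sum1_card (big_morph odd oddD (erefl _)) [LHS]big_mkcond /=.
  by apply: eq_bigr => x _; case: (x \in X).
by rewrite !cardE -big_split; apply: eq_bigr => x _; rewrite inE.
Qed.

Lemma card_symdiff (U : finType) (A B : {set U}) :
  #|symdiff A B| + 2 * #|A :&: B| = #|A| + #|B|.
Proof.
rewrite -(cardsID B A) -(cardsID A B) [B :&: A]setIC.
have -> : symdiff A B = (A :\: B) :|: (B :\: A).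
  by apply/setP => x; rewrite !inE; case: (x \in A); case: (x \in B).
rewrite cardsU (_ : _ :&: _ = set0) ?cards0; first by lia.
by apply/setP => x; rewrite !inE; case: (x \in A); case: (x \in B).
Qed.

Lemma card_symdiff_le (U : finType) (A B : {set U}) :
  #|symdiff A B| <= #|A| + #|B|.
Proof. by rewrite -card_symdiff leq_addr. Qed.

Definition star C v : {set {set T}} := [set f in C | v \in f].

Definition deg C v : nat := #|star C v|.

Definition even_set C : bool := [forall v, ~~ odd (deg C v)].

Lemma even_setP C : reflect (forall v, odd (deg C v) = false) (even_set C).
Proof.
by apply: (iffP forallP) => h v; [apply/negbTE | rewrite h].
Qed.

Lemma odd_deg_symdiff C D v :
  odd (deg (symdiff C D) v) = odd (deg C v) (+) odd (deg D v).
Proof.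
rewrite -odd_card_symdiff; congr (odd #|pred_of_set _|).
by apply/setP => f; rewrite !inE; case: (v \in f); rewrite ?andbT ?andbF.
Qed.

Lemma even_symdiff C D : even_set C -> even_set D -> even_set (symdiff C D).
Proof.
move=> /even_setP hC /even_setP hD; apply/even_setP => v.
by rewrite odd_deg_symdiff hC hD.
Qed.

Lemma eq_set2 (a b c d : T) : ([set a; b] == [set c; d]) =
  ((a == c) && (b == d)) || ((a == d) && (b == c)).
Proof.
apply/eqP/idP => [|/orP[]/andP[/eqP-> /eqP->]]; last 2 first.
- by [].
- by rewrite setUC.
move=> e.
have := set21 a b; rewrite e !inE; have := set22 a b; rewrite e !inE.
have := set21 c d; rewrite -e !inE; have := set22 c d; rewrite -e !inE.
do 4 case/orP => /eqP ?; subst; rewrite ?eqxx ?orbT //.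
Qed.

Lemma edgeP E f x : simple_graph E -> f \in E -> x \in f ->
  exists2 y, y != x & f = [set x; y].
Proof.
move=> sE fE xf; have /eqP/cards2P[a [b [ab fab]]] := sE _ fE.
move: xf; rewrite fab !inE => /orP[] /eqP ->; first by exists b; rewrite // eq_sym.
by exists a => //; rewrite setUC.
Qed.

Lemma edge_neq E x y : simple_graph E -> [set x; y] \in E -> x != y.
Proof. by move=> sE /sE; rewrite cards2; case: eqVneq. Qed.

Lemma sub_simple C E : C \subset E -> simple_graph E -> simple_graph C.
Proof. by move=> /subsetP CE sE f /CE /sE. Qed.

Lemma card_seq_le (U : finType) (A : {set U}) (s : seq U) :
  uniq s -> all (mem A) s -> size s <= #|A|.
Proof.
move=> us /allP sA; rewrite -(card_uniqP us); apply: subset_leq_card.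
by apply/subsetP => x /sA.
Qed.

Lemma card_seq_eq (U : finType) (A : {set U}) (s : seq U) :
  uniq s -> all (mem A) s -> size s = #|A| -> A = [set x in s].
Proof.
move=> us /allP sA e; apply/esym/eqP; rewrite eqEcard; apply/andP; split.
  by apply/subsetP => x; rewrite inE => /sA.
by rewrite -e cardsE (card_uniqP us).
Qed.

(** Degrees in C are even, so an edge of C that enters y is followed by another
one. *)
Lemma even_next C x y : simple_graph C -> even_set C -> [set x; y] \in C ->
  exists z, [/\ z != x, z != y & [set y; z] \in C].
Proof.
move=> sC /even_setP/(_ y) ev xyC.
have fy : [set x; y] \in star C y by rewrite !inE xyC eqxx orbT.
have /set0Pn[g] : star C y :\ [set x; y] != set0.
  by rewrite -card_gt0; move: ev; rewrite /deg (cardsD1 [set x; y]) fy; case: #|_|.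
rewrite !inE => /and3P[gxy gC yg]; have [z zy gE] := edgeP sC gC yg.
exists z; split=> //; last by rewrite -gE.
by apply: contraNneq gxy => zx; rewrite gE zx setUC.
Qed.

Lemma even_card_ge3 C : simple_graph C -> even_set C -> C != set0 -> 2 < #|C|.
Proof.
move=> sC eC /set0Pn[f fC].
have /eqP/cards2P[x [y [xy fE]]] := sC _ fC; subst f.
have [z [zx zy yz]] := even_next sC eC fC.
have yxC : [set y; x] \in C by rewrite setUC.
have [a [ay ax xa]] := even_next sC eC yxC.
apply: (@card_seq_le _ _ [:: [set x; y]; [set y; z]; [set x; a]]).
  rewrite /= !inE !eq_set2 !negb_or (eq_sym y x) (negbTE xy) !eqxx /=.
  by rewrite (eq_sym x z) (negbTE zx) (eq_sym y a) (negbTE ay) ?andbF.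
by rewrite /= fC yz xa.
Qed.

Lemma even_triangle C x y : simple_graph C -> even_set C -> #|C| = 3 ->
  [set x; y] \in C ->
  exists z, [/\ z != x, z != y & C = [set [set x; y]; [set y; z]; [set x; z]]].
Proof.
move=> sC eC c3 xyC; have xy := edge_neq sC xyC.
have [z [zx zy yz]] := even_next sC eC xyC.
have yxC : [set y; x] \in C by rewrite setUC.
have [a [ay ax xa]] := even_next sC eC yxC.
have CE : C = [set g in [:: [set x; y]; [set y; z]; [set x; a]]].
  apply: card_seq_eq; rewrite ?c3 //=; last by rewrite xyC yz xa.
  rewrite !inE !eq_set2 !negb_or (eq_sym y x) (negbTE xy) !eqxx /=.
  by rewrite (eq_sym x z) (negbTE zx) (eq_sym y a) (negbTE ay) ?andbF.
exists z; split=> //.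
suff az : a = z by rewrite CE az; apply/setP => g; rewrite !inE orbA.
have [b [by_ bz zb]] := even_next sC eC yz.
move: zb; rewrite CE !inE !eq_set2 (negbTE zx) (negbTE zy) (negbTE by_) !andbF /=.
by rewrite ?orbF => /andP[/eqP-> _].
Qed.

Lemma even_setD C D : D \subset C -> even_set C -> even_set D ->
  even_set (C :\: D).
Proof.
move=> /subsetP DC eC eD; have := even_symdiff eC eD; congr even_set.
by apply/setP => f; rewrite !inE; case: (boolP (f \in D)) => [/DC->|_];
  rewrite ?addbF.
Qed.

(** The difference of two nested even sets is even, hence has no edge or at least
three. *)
Lemma even_sub_eq C D : simple_graph C -> even_set C -> even_set D ->
  D \subset C -> #|C| <= #|D| + 2 -> D = C.
Proof.
move=> sC eC eD DC le; apply/eqP; rewrite eqEsubset DC -setD_eq0.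
apply: contraTT le => /(even_card_ge3 _ (even_setD DC eC eD)).
rewrite -ltnNge => h; have := h (sub_simple (subsetDl _ _) sC).
by rewrite cardsD (setIidPr DC); have := subset_leq_card DC; lia.
Qed.

Lemma triangle_even x y z : x != y -> y != z -> x != z ->
  even_set [set [set x; y]; [set y; z]; [set x; z]].
Proof.
move=> xy yz xz; apply/even_setP => v; rewrite /deg /star.
have -> : [set f in [set [set x; y]; [set y; z]; [set x; z]] | v \in f] =
   [set f in filter (fun g : {set T} => v \in g) [:: [set x; y]; [set y; z]; [set x; z]]].
  by apply/setP => f; rewrite !inE mem_filter !inE orbA andbC.
rewrite cardsE (card_uniqP _); last first.
  apply: filter_uniq; rewrite /= !inE !eq_set2 !negb_or !eqxx /= (negbTE xz).
  by rewrite (negbTE yz) (negbTE xy) (eq_sym y x) (negbTE xy) !andbF.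
rewrite /= !inE; case: (eqVneq v x) => [vx|_]; case: (eqVneq v y) => [vy|_];
  case: (eqVneq v z) => [vz|_] //; move: xy yz xz;
  by rewrite -?vx -?vy -?vz ?eqxx.
Qed.

Lemma card_triangle x y z : x != y -> y != z -> x != z ->
  #|[set [set x; y]; [set y; z]; [set x; z]]| = 3.
Proof.
move=> xy yz xz.
have -> : [set [set x; y]; [set y; z]; [set x; z]] =
   [set f in [:: [set x; y]; [set y; z]; [set x; z]]].
  by apply/setP => f; rewrite !inE orbA.
rewrite cardsE (card_uniqP _) //= !inE !eq_set2 !negb_or !eqxx /= (negbTE xz).
by rewrite (negbTE yz) (negbTE xy) (eq_sym y x) (negbTE xy) !andbF.
Qed.

(** Removing a triangle from an even set of four or five edges would leave an even
set of one or two edges. *)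
Lemma even_no_triangle C x y z : simple_graph C -> even_set C ->
  3 < #|C| <= 5 -> [set x; y] \in C -> [set y; z] \in C -> [set z; x] \in C ->
  False.
Proof.
move=> sC eC c45 xyC yzC zxC.
have xy := edge_neq sC xyC; have yz := edge_neq sC yzC.
have xz : x != z by rewrite eq_sym (edge_neq sC zxC).
have e3 := card_triangle xy yz xz.
have := even_sub_eq sC eC (triangle_even xy yz xz); rewrite e3.
move=> h; have : #|[set [set x; y]; [set y; z]; [set x; z]]| = #|C|.
  rewrite h //; last by case/andP: c45.
  by apply/subsetP => f; rewrite !inE => /orP[/orP[]|] /eqP-> //; rewrite setUC.
by rewrite e3 => c3; rewrite -c3 in c45.
Qed.

Lemma even_walk3 C x y : simple_graph C -> even_set C -> 3 < #|C| <= 5 ->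
  [set x; y] \in C -> exists z a, [/\ uniq [:: x; y; z; a],
    [set y; z] \in C & [set z; a] \in C].
Proof.
move=> sC eC c45 xyC; have xy := edge_neq sC xyC.
have [z [zx zy yz]] := even_next sC eC xyC.
have [a [ay az za]] := even_next sC eC yz.
exists z, a; split=> //=; rewrite !inE !negb_or xy (eq_sym x z) zx.
rewrite (eq_sym y z) zy (eq_sym y a) ay (eq_sym z a) az !andbT /=.
apply/eqP => ax; subst a; exact: even_no_triangle sC eC c45 xyC yz za.
Qed.

Lemma even_C4 C x y : simple_graph C -> even_set C -> #|C| = 4 ->
  [set x; y] \in C -> exists z a, uniq [:: x; y; z; a] /\
    C = [set f in [:: [set x; y]; [set y; z]; [set z; a]; [set a; x]]].
Proof.
move=> sC eC c4 xyC; have c45 : 3 < #|C| <= 5 by rewrite c4.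
have [z [a [U yz za]]] := even_walk3 sC eC c45 xyC.
have yxC : [set y; x] \in C by rewrite setUC.
have [b [by_ bx xb]] := even_next sC eC yxC.
exists z, a; split=> //.
move: U; rewrite /= !inE !negb_or -!andbA andbT => /and5P[xy xz xa yz' /andP[ya za']].
have CE : C = [set f in [:: [set x; y]; [set y; z]; [set z; a]; [set x; b]]].
  apply: card_seq_eq; rewrite ?c4 //=; last by rewrite xyC yz za xb.
  rewrite !inE !eq_set2 !negb_or !eqxx (negbTE xy) (negbTE xz) (negbTE xa).
  rewrite (negbTE ya) (eq_sym y x) (negbTE xy) (eq_sym z x) (negbTE xz).
  by rewrite (eq_sym a x) (negbTE xa) (eq_sym y b) (negbTE by_) (negbTE yz') ?andbF.
have [c [cz ca ac]] := even_next sC eC za.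
move: ac; rewrite CE !inE !eq_set2 (negbTE cz) (eq_sym a x) (negbTE xa).
rewrite (eq_sym a y) (negbTE ya) (eq_sym a z) (negbTE za') !andbF /=.
move=> /andP[/eqP ab _]; apply/setP => f; rewrite !inE ab.
by rewrite [[set x; b]]setUC.
Qed.

(** A walk x, y, z, a, b along C cannot come back earlier: a triangle is excluded by
counting, and a 4-cycle turns into a triangle after adding modulo 2 the triangle
on three of its vertices. Four edges being used, the fifth one has to leave both
x and b. *)
Lemma even_C5 C : simple_graph C -> even_set C -> #|C| = 5 ->
  exists x y z a b, [/\ uniq [:: x; y; z; a; b], [set x; y] \in C,
    [set y; z] \in C, [set z; a] \in C & [set a; b] \in C /\ [set b; x] \in C].
Proof.
move=> sC eC c5; have c45 : 3 < #|C| <= 5 by rewrite c5.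
have /set0Pn[f xyC] : C != set0 by rewrite -card_gt0 c5.
have /eqP/cards2P[x [y [xy fE]]] := sC _ xyC; subst f.
have [z [a [U yz za]]] := even_walk3 sC eC c45 xyC.
have [b [bz ba ab]] := even_next sC eC za.
move: U; rewrite /= !inE !negb_or -!andbA andbT.
move=> /and5P[_ xz xa yz' /andP[ya za']].
have bney : b != y.
  by apply/eqP => e; subst b; exact: even_no_triangle sC eC c45 yz za ab.
have yxC : [set y; x] \in C by rewrite setUC.
have [c [cy cx xc]] := even_next sC eC yxC.
have bnex : b != x.
  apply/eqP => e; subst b.
  (* The 4-cycle x, y, z, a plus a fifth edge: adding the triangle x, y, z leaves
     an even set of four edges that contains the triangle x, z, a. *)
  pose t := [set [set x; y]; [set y; z]; [set x; z]].
  have xzC : [set x; z] \notin C.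
    by apply/negP; rewrite setUC => /(even_no_triangle sC eC c45 xyC yz).
  have tE : C :&: t = t :\ [set x; z].
    apply/setP => f; rewrite !inE.
    case: (eqVneq f [set x; z]) => [->|_] /=; first by rewrite (negbTE xzC).
    by rewrite orbF; case: eqVneq => [->|_]; [|case: eqVneq => [->|_]];
      rewrite ?xyC ?yz ?andbF.
  have t2 : #|t :\ [set x; z]| = 2.
    have := cardsD1 [set x; z] t.
    by rewrite (card_triangle xy yz' xz) !inE eqxx orbT => -[].
  have := card_symdiff C t; rewrite tE t2 c5 (card_triangle xy yz' xz) => cD.
  have eD := even_symdiff eC (triangle_even xy yz' xz); rewrite -/t in eD.
  have sD : simple_graph (symdiff C t).
    move=> f; rewrite !inE; case: (boolP (f \in C)) => [/sC //|_] /=.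
    by rewrite -orbA => /or3P[] /eqP ->; rewrite cards2 ?xy ?yz' ?xz.
  apply: (even_no_triangle sD eD (_ : _ < _ <= _) (_ : [set x; z] \in _)
    (_ : [set z; a] \in _) (_ : [set a; x] \in _)).
  - by rewrite (_ : #|_| = 4) //; apply: (@addIn 4); rewrite cD.
  - by rewrite !inE (negbTE xzC) !eqxx !orbT.
  - rewrite !inE za !eq_set2 (eq_sym a y) (negbTE ya) (eq_sym z x) (negbTE xz).
    by rewrite (eq_sym z y) (negbTE yz') (eq_sym a x) (negbTE xa) !andbF.
  - rewrite !inE ab !eq_set2 (eq_sym a y) (negbTE ya) (eq_sym a x) (negbTE xa).
    by rewrite (eq_sym a z) (negbTE za').
have [d [da db chain_bd]] := even_next sC eC ab.
have CE : C = [set f in [:: [set x; y]; [set y; z]; [set z; a]; [set a; b]; [set x; c]]].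
  apply: card_seq_eq; rewrite ?c5 //=; last by rewrite xyC yz za ab xc.
  rewrite !inE !eq_set2 !negb_or !eqxx (negbTE xy) (negbTE xz) (negbTE xa).
  rewrite (negbTE ya) (eq_sym y x) (negbTE xy) (eq_sym z x) (negbTE xz).
  rewrite (eq_sym a x) (negbTE xa) (eq_sym y c) (negbTE cy) (negbTE yz').
  by rewrite (negbTE za') (eq_sym y b) (negbTE bney) (eq_sym z b) (negbTE bz)
    ?(eq_sym b x) ?(eq_sym x b) ?(negbTE bnex) ?andbF.
exists x, y, z, a, b; split=> //; last first.
- split=> //; have -> : b = c; last by rewrite setUC.
  move: chain_bd; rewrite CE !inE !eq_set2 (negbTE bnex) (negbTE bney).
  rewrite (negbTE bz) (negbTE ba) (negbTE da) !andbF !orbF /=.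
  by case/andP => /eqP.
- rewrite /= !inE !negb_or xy xz xa yz' ya za' (eq_sym x b) bnex.
  by rewrite (eq_sym y b) bney (eq_sym z b) bz (eq_sym a b) ba.
Qed.

End EvenSets.

(** * Abstract duals and the Euler inequality *)

Section Duals.
Variables (T I : finType).
Implicit Types (C D E : {set {set T}}) (f : {set T}) (l r : {set T} -> I).
Implicit Types (A B F : {set I}).

Definition cut E l r A : {set {set T}} :=
  [set f in E | (l f \in A) != (r f \in A)].

Definition abstract_dual E l r : Prop :=
  forall C, C \subset E -> even_set C <-> exists A, C = cut E l r A.

(** The set F of faces is part of the data so that a dual can be shrunk without
changing the type of faces. The last condition is connectedness of the dual
multigraph. *)
Definition connected_faces E l r F : Prop :=
  [/\ forall f, f \in E -> (l f \in F) && (r f \in F),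
      abstract_dual E l r &
      forall A, A \subset F -> cut E l r A = set0 -> A = set0 \/ A = F].

Lemma cut_symdiff E l r A B :
  cut E l r (symdiff A B) = symdiff (cut E l r A) (cut E l r B).
Proof.
apply/setP => f; rewrite !inE; case: (f \in E) => //=.
by case: (l f \in A); case: (r f \in A); case: (l f \in B); case: (r f \in B).
Qed.

Lemma cutI E l r F A : (forall f, f \in E -> (l f \in F) && (r f \in F)) ->
  cut E l r (A :&: F) = cut E l r A.
Proof.
move=> lrF; apply/setP => f; rewrite !inE; case: (boolP (f \in E)) => //= fE.
by have /andP[-> ->] := lrF f fE; rewrite !andbT.
Qed.

Lemma cutC E l r F A : (forall f, f \in E -> (l f \in F) && (r f \in F)) ->
  cut E l r (F :\: A) = cut E l r A.
Proof.
move=> lrF; apply/setP => f; rewrite !inE; case: (boolP (f \in E)) => //= fE.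
have /andP[-> ->] := lrF f fE; rewrite !andbT.
by case: (l f \in A); case: (r f \in A).
Qed.

Lemma cut_sub E l r A : cut E l r A \subset E.
Proof. by apply/subsetP => f; rewrite inE => /andP[]. Qed.

(** A dual with as few faces as possible is connected: identifying two faces that
lie in different components does not change the cuts. *)
Lemma connected_faces_exist E l r F :
    (forall f, f \in E -> (l f \in F) && (r f \in F)) -> abstract_dual E l r ->
  exists F' l' r', connected_faces E l' r' F'.
Proof.
have [n] := ubnP #|F|; elim: n => // n IHn in F l r * => ltFn lrF dE.
have [|] := boolP [forall A : {set I}, (A \subset F) ==>
  (cut E l r A == set0) ==> ((A == set0) || (A == F))].
  move/forallP => h; exists F, l, r; split=> // A AF cA.
  move: (h A); rewrite AF cA eqxx /= => /orP[]/eqP; by [left|right].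
rewrite negb_forall => /existsP[A]; rewrite !negb_imply negb_or.
case/and4P => AF /eqP cA /set0Pn[s sA] AnF.
have [t tF tA] : exists2 t, t \in F & t \notin A.
  by apply/subsetPn; apply: contra AnF => FA; rewrite eqEsubset AF.
have stn : s != t by apply: contraNneq tA => <-.
have sF : s \in F by rewrite (subsetP AF).
pose m i := if i == t then s else i.
have mF i : i \in F -> m i \in F :\ t.
  by move=> iF; rewrite /m !inE; case: (eqVneq i t) => [_|->]; rewrite ?stn ?sF.
apply: (IHn (F :\ t) (m \o l) (m \o r)).
- by move: ltFn; rewrite (cardsD1 t F) tF.
- by move=> f fE /=; have /andP[lF rF] := lrF f fE; rewrite !mF.
have cutm B : cut E (m \o l) (m \o r) B = cut E l r [set i | m i \in B].
  by apply/setP => f; rewrite !inE.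
move=> C CE; split=> [/(dE C CE)[B CB]|[B ->]]; last first.
  by rewrite cutm; apply/(dE _ (cut_sub _ _ _ _)); exists [set i | m i \in B].
have [B' [CB' stB]] : exists B', C = cut E l r B' /\ (s \in B') = (t \in B').
  case: (eqVneq (s \in B) (t \in B)) => [e|ne]; first by exists B.
  exists (symdiff B A); rewrite cut_symdiff cA; split.
    by rewrite -CB; apply/setP => f; rewrite [RHS]inE in_set0 addbF.
  by rewrite !inE sA (negbTE tA); case: (s \in B) ne; case: (t \in B).
exists B'; rewrite cutm CB'; congr cut; apply/setP => i; rewrite inE /m.
by case: eqVneq => // ->; rewrite stB.
Qed.

Definition boundary C : {set T} := [set v | odd (deg C v)].

Lemma even_boundary C : even_set C = (boundary C == set0).
Proof.
apply/even_setP/eqP => [h|h v]; first by apply/setP => v; rewrite !inE h.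
by have := in_set0 v; rewrite -h inE.
Qed.

Lemma boundary_symdiff C D :
  boundary (symdiff C D) = symdiff (boundary C) (boundary D).
Proof. by apply/setP => v; rewrite !inE odd_deg_symdiff. Qed.

Lemma sum_deg (C : {set {set T}}) : \sum_v deg C v = \sum_(f in C) #|f|.
Proof.
under eq_bigr => v _ do rewrite /deg -sum1_card.
rewrite (exchange_big_dep (mem C)) /=; last by move=> v f _; rewrite inE => /andP[].
apply: eq_bigr => f fC; rewrite -sum1_card; apply: eq_bigl => v.
by rewrite inE fC.
Qed.

Lemma boundary_even_card C : simple_graph C -> odd #|boundary C| = false.
Proof.
move=> sC; have : odd (\sum_v deg C v) = false.
  rewrite sum_deg (eq_bigr (fun=> 2)) => [|f /sC //].
  by rewrite sum_nat_const oddM andbF.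
rewrite (big_morph odd oddD (erefl _)) => <-.
rewrite -sum1_card (big_morph odd oddD (erefl _)) big_mkcond /=.
by apply: eq_bigr => v _; rewrite inE; case: odd.
Qed.

Lemma boundary_sub C (V : {set T}) : (forall f, f \in C -> f \subset V) ->
  boundary C \subset V.
Proof.
move=> CV; apply/subsetP => v; rewrite inE => od.
have /card_gt0P[f] : 0 < deg C v by case: deg od.
by rewrite inE => /andP[/CV/subsetP fV /fV].
Qed.

Lemma symdiffK (U : finType) (A B : {set U}) : symdiff A (symdiff A B) = B.
Proof. by apply/setP => x; rewrite !inE addbA addbb. Qed.

Lemma symdiff_eq0 (U : finType) (A : {set U}) : symdiff A A = set0.
Proof. by apply/setP => x; rewrite !inE addbb. Qed.

(** A set C of edges is determined by its boundary and by a face set: the difference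
of C with a fixed set of the same boundary is even, hence a cut. The boundary has
even cardinal, so it can be recovered after deleting v0, and complementary face
sets have the same cut, so i0 can be kept out. Counting gives
2 ^ e <= 2 ^ (n - 1) * 2 ^ (f - 1). *)
Lemma euler_ineq E l r F (V : {set T}) v0 i0 :
    simple_graph E -> (forall f, f \in E -> f \subset V) ->
    (forall f, f \in E -> (l f \in F) && (r f \in F)) -> abstract_dual E l r ->
    v0 \in V -> i0 \in F ->
  #|E| + 2 <= #|V| + #|F|.
Proof.
move=> sE EV lrF dE v0V i0F.
pose key C := boundary C :\ v0.
have keyE C D : C \subset E -> D \subset E -> key C = key D ->
    boundary C = boundary D.
  move=> CE DE kCD; have := boundary_even_card (sub_simple CE sE).
  have := boundary_even_card (sub_simple DE sE).
  rewrite (cardsD1 v0) (cardsD1 v0 (boundary C)) -/(key C) -/(key D) kCD !oddD.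
  move=> e1 e2; have e : (v0 \in boundary C) = (v0 \in boundary D).
    by move: e1 e2; case: (odd #|_|); do 2 case: (_ \in _).
  apply/setP => v; case: (eqVneq v v0) => [->//|vv0].
  by move/setP: kCD => /(_ v); rewrite !inE vv0.
pose rep C := odflt set0 [pick D : {set {set T}} | (D \subset E) && (key D == key C)].
have repP C : C \subset E -> rep C \subset E /\ key (rep C) = key C.
  move=> CE; rewrite /rep; case: pickP => [D /andP[DE /eqP]//|/(_ C)].
  by rewrite CE eqxx.
have rep_key C D : key C = key D -> rep C = rep D by rewrite /rep => ->.
pose face C := odflt set0 [pick A : {set I} | (A \subset F :\ i0) &&
  (cut E l r A == symdiff (rep C) C)].
have symE C D : C \subset E -> D \subset E -> symdiff C D \subset E.
  move=> /subsetP CE /subsetP DE; apply/subsetP => f; rewrite inE.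
  by case: (boolP (f \in C)) => [/CE//|_ /= /DE].
have faceP C : C \subset E ->
    face C \subset F :\ i0 /\ cut E l r (face C) = symdiff (rep C) C.
  move=> CE; rewrite /face; case: pickP => [A /andP[AF /eqP]//|none].
  have [rE rk] := repP C CE.
  have /(dE _ (symE _ _ rE CE))[A eA] : even_set (symdiff (rep C) C).
    by rewrite even_boundary boundary_symdiff (keyE _ _ rE CE rk) symdiff_eq0.
  exfalso; case: (boolP (i0 \in A)) => i0A.
    have := none (F :\: A); rewrite (cutC _ lrF) eA eqxx andbT => /negP; apply.
    apply/subsetP => i; rewrite !inE => /andP[iA ->]; rewrite andbT.
    by apply: contraNneq iA => ->.
  have := none (A :&: F); rewrite (cutI _ lrF) eA eqxx andbT => /negP; apply.
  apply/subsetP => i; rewrite !inE => /andP[iA ->]; rewrite andbT.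
  by apply: contraNneq i0A => <-.
have inj : {in powerset E &, injective (fun C => (key C, face C))}.
  move=> C D; rewrite !inE => CE DE [kCD fCD].
  have [_ eC] := faceP C CE; have [_ eD] := faceP D DE.
  by rewrite -[C](symdiffK (rep C)) -eC fCD eD (rep_key _ _ kCD) symdiffK.
have : #|(fun C => (key C, face C)) @: powerset E| <=
    #|setX (powerset (V :\ v0)) (powerset (F :\ i0))|.
  apply: subset_leq_card; apply/subsetP => _ /imsetP[C CE ->].
  rewrite inE in CE; have [fF _] := faceP C CE.
  rewrite !inE fF andbT; apply: setSD; apply: boundary_sub => f fC.
  by apply: EV; exact: (subsetP CE).
rewrite (card_in_imset inj) cardsX !card_powerset -expnD leq_exp2l //.
by rewrite (cardsD1 v0 V) (cardsD1 i0 F) v0V i0F; lia.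
Qed.

End Duals.

Definition has_dual (T : finType) (E : {set {set T}}) : Prop :=
  exists (I : finType) (l r : {set T} -> I), abstract_dual E l r.

Lemma has_dual0 (T : finType) : has_dual (set0 : {set {set T}}).
Proof.
exists unit, (fun=> tt), (fun=> tt) => C; rewrite subset0 => /eqP->; split=> _.
  by exists set0; apply/setP => f; rewrite !inE.
apply/even_setP => v; rewrite /deg (_ : star set0 v = set0) ?cards0 //.
by apply/setP => f; rewrite !inE.
Qed.

(** * Cycles and faces of two-connected graphs *)

Section TwoConnected.
Variable T : finType.
Implicit Types (C D E : {set {set T}}) (f g : {set T}) (V : {set T}).

Definition avoid E x : rel T :=
  fun u w => [&& [set u; w] \in E, u != x & w != x].

(** The graphs considered have at least five vertices and no isolated vertex, so that
this is the usual notion: connectedness after the removal of any vertex. *)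
Definition two_connected V E : Prop :=
  forall x a b, x \in V -> a \in V -> b \in V -> a != x -> b != x ->
    connect (avoid E x) a b.

Lemma star1 f v : odd (deg [set f] v) = (v \in f).
Proof.
rewrite /deg; case: (boolP (v \in f)) => vf.
  suff -> : star [set f] v = [set f] by rewrite cards1.
  by apply/setP => g; rewrite !inE; case: eqVneq => // ->.
suff -> : star [set f] v = set0 by rewrite cards0.
by apply/setP => g; rewrite !inE; case: eqVneq => // ->; rewrite (negbTE vf).
Qed.

Lemma deg0 (v : T) : deg set0 v = 0.
Proof. by apply/eqP; rewrite cards_eq0; apply/eqP/setP => g; rewrite !inE. Qed.

Lemma connect_chain E x a b : simple_graph E -> connect (avoid E x) a b ->
  exists P : {set {set T}}, [/\ P \subset E, forall f, f \in P -> x \notin f &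
    forall v, odd (deg P v) = (v == a) (+) (v == b)].
Proof.
move=> sE /connectP[p]; elim: p => [|c p IHp] in a *.
  by move=> _ ->; exists set0; split=> [|f|v]; rewrite ?sub0set ?inE // deg0 addbb.
move=> /= /andP[/and3P[acE ax cx] pp] /(IHp _ pp)[P [PE Px dP]].
exists (symdiff [set [set a; c]] P); split.
- by apply/subsetP => f; rewrite !inE; case: eqVneq => [-> //|_ /=]; exact: (subsetP PE).
- move=> f; rewrite !inE; case: eqVneq => [-> _|_ /=]; last exact: Px.
  by rewrite !inE negb_or !(eq_sym x) ax.
move=> v; rewrite odd_deg_symdiff dP star1 !inE addbA.
have ac := edge_neq sE acE.
by case: (eqVneq v a) => [->|_]; rewrite ?(negbTE ac) // addbb.
Qed.

Section Cycles.
Variables (V : {set T}) (E : {set {set T}}).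
Hypotheses (sE : simple_graph E) (EV : forall f, f \in E -> f \subset V).
Hypothesis (conn : two_connected V E).

Lemma edge_ends x y : [set x; y] \in E -> x \in V /\ y \in V.
Proof. by move=> /EV/subsetP h; split; apply: h; rewrite !inE eqxx ?orbT. Qed.

(** A path from a to b that avoids x is closed by the edges xa and xb. Only the
degrees of this cycle matter later, so it is given as an even set of edges. *)
Lemma cycle_through x a b : [set x; a] \in E -> [set x; b] \in E -> a != b ->
  exists C, [/\ C \subset E, even_set C & star C x = [set [set x; a]; [set x; b]]].
Proof.
move=> xaE xbE ab; have [xV aV] := edge_ends xaE; have [_ bV] := edge_ends xbE.
have xa := edge_neq sE xaE; have xb := edge_neq sE xbE.
have [ax bx] : a != x /\ b != x by rewrite !(eq_sym _ x).
have [P [PE Px dP]] := connect_chain sE (conn xV aV bV ax bx).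
exists (symdiff P (symdiff [set [set x; a]] [set [set x; b]])); split.
- apply/subsetP => f; rewrite !inE; case: (boolP (f \in P)) => [/(subsetP PE)//|_ /=].
  by case: eqVneq => [-> //|_ /=] /eqP ->.
- apply/even_setP => v; rewrite !odd_deg_symdiff !star1 dP !inE.
  case: (eqVneq v x) => [->|_]; first by rewrite (negbTE xa) (negbTE xb).
  by case: (v == a); case: (v == b).
- apply/setP => f; rewrite !inE.
  have e : [set x; a] != [set x; b] by rewrite eq_set2 (negbTE ab) (negbTE xb) andbF.
  have nP c : ([set x; c] \in P) = false.
    by apply/negP => /Px; rewrite !inE eqxx.
  case: (eqVneq f [set x; a]) => [->|_]; first by rewrite nP (negbTE e) !inE eqxx.
  case: (eqVneq f [set x; b]) => [->|_]; first by rewrite nP !inE eqxx.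
  by rewrite /= addbF; apply/andP => -[fP]; rewrite (negbTE (Px _ fP)).
Qed.

Variables (I : finType) (F : {set I}) (l r : {set T} -> I).
Hypothesis dualE : connected_faces E l r F.

Lemma dual_ends f : f \in E -> (l f \in F) && (r f \in F).
Proof. by case: dualE => + _ _; apply. Qed.

Lemma even_cut A : even_set (cut E l r A).
Proof.
by case: dualE => _ d _; apply/(d _ (cut_sub _ _ _ _)); exists A.
Qed.

Lemma even_is_cut C : C \subset E -> even_set C -> exists A, C = cut E l r A.
Proof. by case: dualE => _ d _ CE; move/(d _ CE). Qed.

(** Two edges at x between the same two faces lie on the same cycles, so that a third
edge at x would be on no cycle with just one of them. *)
Lemma parallel_edges x a b c : [set x; a] \in E -> [set x; b] \in E ->
  [set x; c] \in E -> a != b -> c != a -> c != b ->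
  [set l [set x; a]; r [set x; a]] = [set l [set x; b]; r [set x; b]] -> False.
Proof.
move=> xaE xbE xcE ab ca cb e.
have ac : a != c by rewrite eq_sym.
have [C [CE eC sC]] := cycle_through xaE xcE ac.
have [A CA] := even_is_cut CE eC.
have xaC : [set x; a] \in C.
  by have := set21 [set x; a] [set x; c]; rewrite -sC inE => /andP[].
have : [set x; b] \in star C x.
  rewrite !inE eqxx andbT; move: xaC; rewrite CA !inE xaE xbE /=.
  move/eqP: e; rewrite eq_set2 => /orP[]/andP[/eqP-> /eqP->] //.
  by rewrite eq_sym.
rewrite sC !inE !eq_set2 (eq_sym b a) (negbTE ab) (eq_sym b c) (negbTE cb).
rewrite eqxx (negbTE (edge_neq sE xaE)) (negbTE (edge_neq sE xcE)) /=.
by [].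
Qed.

(** A loop of the dual would be in no cut, hence on no cycle. *)
Lemma dual_loopless x a b : [set x; a] \in E -> [set x; b] \in E -> a != b ->
  l [set x; a] != r [set x; a].
Proof.
move=> xaE xbE ab; have [C [CE eC sC]] := cycle_through xaE xbE ab.
have [A CA] := even_is_cut CE eC.
have := set21 [set x; a] [set x; b]; rewrite -sC inE CA !inE xaE => /andP[+ _].
by apply: contraNneq => ->.
Qed.

(** If the property P were constant around each vertex, it would spread along the
paths of the graph. *)
Lemma two_connected_join (P : pred {set T}) g1 g2 :
  g1 \in E -> g2 \in E -> P g1 -> ~~ P g2 ->
  exists x a b, [/\ [set x; a] \in E, [set x; b] \in E, P [set x; a] & ~~ P [set x; b]].
Proof.
move=> g1E g2E Pg1 Pg2.
have /existsP[x /andP[]] : [exists x, [exists g in star E x, P g] &&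
    [exists g in star E x, ~~ P g]]; last first.
  move=> /exists_inP[g + Pg] /exists_inP[h + Ph]; rewrite !inE.
  move=> /andP[gE xg] /andP[hE xh]; have [a _ ga] := edgeP sE gE xg.
  have [b _ hb] := edgeP sE hE xh; subst g h.
  by exists x, a, b; split.
apply: contraT; rewrite negb_exists => /forallP none.
have /eqP/cards2P[a [b [ab eg1]]] := sE g1E; subst g1.
have /eqP/cards2P[c [d [cd eg2]]] := sE g2E; subst g2.
have clash y h1 h2 : h1 \in E -> h2 \in E -> y \in h1 -> y \in h2 -> P h1 -> P h2.
  move=> h1E h2E yh1 yh2 Ph1; apply: contraT => Ph2; move: (none y).
  rewrite negb_and; case/orP => /existsP[].
    by exists h1; rewrite !inE h1E yh1.
  by exists h2; rewrite !inE h2E yh2.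
have [aV bV] := edge_ends g1E; have [cV dV] := edge_ends g2E.
have : connect (avoid E b) a c.
  apply: (conn bV) => //; apply: contraNneq Pg2 => cb; subst c.
  by apply: (clash b) Pg1 => //; rewrite !inE eqxx ?orbT.
move=> /connectP[p]; have : exists2 h, h \in star E a & P h.
  by exists [set a; b] => //; rewrite !inE g1E eqxx.
elim: p a {ab g1E Pg1 aV} => [|u p IHp] a [h].
  rewrite inE => /andP[hE ah] Ph _ ca; subst c.
  by case/negP: Pg2; apply: (clash a) Ph => //; rewrite !inE eqxx.
rewrite inE => /andP[hE ah] Ph /= /andP[/and3P[auE _ _] pp] e.
apply: (IHp u _ pp e); exists [set a; u]; first by rewrite !inE auE eqxx orbT.
by apply: (clash a) Ph => //; rewrite !inE eqxx.
Qed.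

(** A connected dual of a two-connected graph has no cut vertex i. Otherwise the
edges with a face in S, a union of components of the dual without i, would meet every
even set in an even set, so no cycle could leave them; but some vertex has edges
of both kinds, and [cycle_through] applies there. *)
Lemma face_bond (S : {set I}) i : S \subset F -> i \in F -> i \notin S -> S != set0 ->
  i |: S != F -> ~~ (cut E l r S \subset cut E l r [set i]).
Proof.
move=> SF iF iS S0 SiF; apply/negP => /subsetP sub.
case: (dualE) => _ _ cF.
pose P f := (l f \in S) || (r f \in S).
have [g1 g1S] : exists g, g \in cut E l r S.
  apply/set0Pn/eqP => /(cF _ SF)[/eqP|e]; first by rewrite (negbTE S0).
  by rewrite e iF in iS.
have [g2 g2S] : exists g, g \in cut E l r (i |: S).
  have iSF : i |: S \subset F by rewrite subUset sub1set iF.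
  apply/set0Pn/eqP => /(cF _ iSF)[/setP/(_ i)|/eqP]; first by rewrite !inE eqxx.
  by rewrite (negbTE SiF).
have inner f : f \in E -> P f -> (l f \in i |: S) && (r f \in i |: S).
  rewrite /P => fE; rewrite !inE; have := sub f; rewrite !inE fE /=.
  by case: (eqVneq (l f) i) => [->|_]; case: (eqVneq (r f) i) => [->|_];
    rewrite ?(negbTE iS); case: (l f \in S); case: (r f \in S) => // h; have := h isT.
have g1E : g1 \in E by rewrite (subsetP (cut_sub _ _ _ _) _ g1S).
have g2E : g2 \in E by rewrite (subsetP (cut_sub _ _ _ _) _ g2S).
have P1 : P g1 by move: g1S; rewrite inE /P; case: (l g1 \in S); case: (r g1 \in S); rewrite ?andbF.
have P2 : ~~ P g2.
  by apply/negP => /(inner _ g2E) /andP[h1 h2]; move: g2S; rewrite inE h1 h2 andbF.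
have [x [a [b [xaE xbE Pa Pb]]]] := two_connected_join g1E g2E P1 P2.
have ab : a != b by apply: contraNneq Pb => <-.
have [C [CE eC sC]] := cycle_through xaE xbE ab.
have [A0 CA0] := even_is_cut CE eC.
have [A [CA iA]] : exists A, C = cut E l r A /\ i \notin A.
  case: (boolP (i \in A0)) => iA0; last by exists A0.
  by exists (F :\: A0); rewrite (cutC _ dual_ends) !inE iA0.
have /even_setP/(_ x) := even_cut (A :&: S).
suff -> : deg (cut E l r (A :&: S)) x = 1 by [].
apply/eqP/cards1P; exists [set x; a]; apply/setP => f.
have aC : [set x; a] \in star C x by rewrite sC !inE eqxx.
have keep j : j \in i |: S -> (j \in A) && (j \in S) = (j \in A).
  by rewrite !inE => /orP[/eqP->|->]; rewrite ?(negbTE iA) ?andbT.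
have PC f' : f' \in E -> P f' ->
    (f' \in cut E l r (A :&: S)) = (f' \in cut E l r A).
  by move=> fE /(inner _ fE)/andP[hl hr]; rewrite !inE !keep.
rewrite !in_set1; apply/idP/eqP => [|->]; last first.
  move: aC; rewrite inE CA -PC // => /andP[h _].
  by rewrite inE h !inE eqxx.
rewrite inE => /andP[cf xf]; have fE := subsetP (cut_sub _ _ _ _) _ cf.
have Pf : P f.
  by move: cf; rewrite /P !inE; case: (l f \in S); case: (r f \in S); rewrite ?andbF.
have : f \in star C x by rewrite inE CA -PC // cf.
rewrite sC !inE => /orP[/eqP //|/eqP fb].
by rewrite fb (negbTE Pb) in Pf.
Qed.

End Cycles.
End TwoConnected.

(** * Discharging in two-connected graphs of minimum degree three *)

Section Discharging.
Variables (T I : finType) (V : {set T}) (E : {set {set T}}).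
Variables (F : {set I}) (l r : {set T} -> I).
Implicit Types (f g : {set T}) (i t q : I) (u v w x y z : T).
Hypotheses (sE : simple_graph E) (EV : forall f, f \in E -> f \subset V).
Hypothesis (conn : two_connected V E).
Hypothesis dualE : connected_faces E l r F.
Hypothesis noC5 : forall x y z a b, uniq [:: x; y; z; a; b] ->
  [set x; y] \in E -> [set y; z] \in E -> [set z; a] \in E ->
  [set a; b] \in E -> [set b; x] \in E -> False.
Hypothesis mindeg : forall v, v \in V -> 2 < deg E v.
Hypothesis V5 : 4 < #|V|.

Definition sides i : {set {set T}} := cut E l r [set i].
Definition nsides i : nat := #|sides i|.

Lemma third_edge v a b : v \in V ->
  exists c, [/\ [set v; c] \in E, c != a & c != b].
Proof.
move=> vV; have /set0Pn[f] : star E v :\ [set v; a] :\ [set v; b] != set0.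
  rewrite -card_gt0; have := mindeg vV; rewrite /deg.
  rewrite (cardsD1 [set v; a]) (cardsD1 [set v; b] (_ :\ _)).
  by case: #|_| => //; do 2 case: (_ \in _).
rewrite !inE => /and4P[fb fa fE vf]; have [c cv fc] := edgeP sE fE vf.
by exists c; rewrite -fc; split=> //; [apply: contraNneq fa|apply: contraNneq fb]
  => <-; rewrite fc.
Qed.

Lemma loopless f : f \in E -> l f != r f.
Proof.
move=> fE; have /eqP/cards2P[x [a [xa ef]]] := sE fE; subst f.
have [xV _] := edge_ends EV fE; have [c [xcE ca _]] := third_edge a a xV.
by apply: (dual_loopless sE EV conn dualE fE xcE); rewrite eq_sym.
Qed.

Lemma sidesE f i : f \in E -> (f \in sides i) = (l f == i) || (r f == i).
Proof.
move=> fE; rewrite !inE fE /=; have := loopless fE.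
by case: (eqVneq (l f) i) => [->|_]; case: (eqVneq (r f) i).
Qed.

Lemma sides_sub f i : f \in sides i -> f \in E.
Proof. exact: (subsetP (cut_sub _ _ _ _)). Qed.

Lemma sides_face f i : f \in sides i -> i \in F.
Proof.
move=> fi; have fE := sides_sub fi; move: fi; rewrite sidesE //.
by case/andP: (dual_ends dualE fE) => lF rF /orP[]/eqP <-.
Qed.

Lemma sides_even i : even_set (sides i).
Proof. exact: (even_cut dualE). Qed.

Lemma sides_simple i : simple_graph (sides i).
Proof. exact: sub_simple (cut_sub _ _ _ _) sE. Qed.

Lemma sides_two f i j k : f \in sides i -> f \in sides j -> i != j -> f \in sides k ->
  k = i \/ k = j.
Proof.
move=> fi; have fE := sides_sub fi; move: fi; rewrite !sidesE //.
move=> hi hj + hk; move: hi hj hk.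
by do 3 case/orP=> /eqP<-; rewrite ?eqxx // => _; auto.
Qed.

Lemma sides_other f i : f \in sides i -> exists2 j, j != i & f \in sides j.
Proof.
move=> fi; have fE := sides_sub fi; have ne := loopless fE.
move: fi; rewrite sidesE // => /orP[]/eqP <-.
  by exists (r f); rewrite 1?eq_sym // sidesE // eqxx orbT.
by exists (l f); rewrite // sidesE // eqxx.
Qed.

Lemma sides_ends f i j : f \in sides i -> f \in sides j -> i != j ->
  [set l f; r f] = [set i; j].
Proof.
move=> fi fj ij; have fE := sides_sub fi.
have fl : f \in sides (l f) by rewrite sidesE // eqxx.
have fr : f \in sides (r f) by rewrite sidesE // eqxx orbT.
have := loopless fE.
case: (sides_two fi fj ij fl) => ->; case: (sides_two fi fj ij fr) => ->;
  by rewrite ?eqxx // setUC.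
Qed.

(** By Euler's inequality, since all degrees are at least 3. *)
Lemma many_faces : 4 < #|F|.
Proof.
have e3 : 3 * #|V| <= 2 * #|E|.
  have <- : \sum_v deg E v = 2 * #|E|.
    by rewrite sum_deg (eq_bigr (fun=> 2)) => [|f /sE //]; rewrite sum_nat_const mulnC.
  rewrite mulnC -sum_nat_const [X in _ <= X](bigID (mem V)) /=.
  by apply: leq_trans (leq_addr _ _); apply: leq_sum => v /mindeg.
have [v0 v0V] : exists v, v \in V by apply/card_gt0P; apply: leq_trans V5.
have [f fE] : exists f, f \in E.
  by apply/card_gt0P; move: e3 V5; case: #|E| => //; case: #|V|.
have /andP[lF _] := dual_ends dualE fE.
case: (dualE) => lrF dE _.
have := euler_ineq sE EV lrF dE v0V lF; move: e3 V5.
by move: #|V| #|E| #|F| => n e k; lia.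
Qed.

Lemma few_faces (A : {set I}) : A \subset F -> A != set0 -> #|A| < 5 ->
  cut E l r A != set0.
Proof.
move=> AF A0 A4; apply/eqP; case: dualE => _ _ /(_ _ AF) h /h[/eqP|e].
  by rewrite (negbTE A0).
by move: A4; rewrite e ltnNge many_faces.
Qed.

Lemma nsides_cases i : i \in F -> [\/ nsides i = 3, nsides i = 4 | 6 <= nsides i].
Proof.
move=> iF; have n0 : sides i != set0.
  by apply: few_faces; rewrite ?sub1set ?cards1 // -card_gt0 cards1.
have := even_card_ge3 (@sides_simple i) (sides_even i) n0; rewrite -/(nsides i).
have n5 : nsides i <> 5.
  move/(even_C5 (@sides_simple i) (sides_even i)) => [x [y [z [a [b]]]]].
  case=> U /sides_sub e1 /sides_sub e2 /sides_sub e3 [/sides_sub e4 /sides_sub e5].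
  exact: noC5 U e1 e2 e3 e4 e5.
move: (nsides i) n5 => [|[|[|[|[|[|k]]]]]] //= _ _; by [left|right;left|right;right|constructor].
Qed.

Definition triface t x y z : Prop :=
  [/\ [&& x != y, y != z & x != z], t \in F &
      sides t = [set [set x; y]; [set y; z]; [set x; z]]].

Lemma triface_rot t x y z : triface t x y z -> triface t y z x.
Proof.
case=> /and3P[xy yz xz] tF bE; split=> //.
  by rewrite yz (eq_sym z) xz (eq_sym y) xy.
by rewrite bE; apply/setP => f; rewrite !inE [[set z; x]]setUC [[set y; x]]setUC;
  do 3 case: (_ == _).
Qed.

Lemma triface_swap t x y z : triface t x y z -> triface t y x z.
Proof.
case=> /and3P[xy yz xz] tF bE; split=> //.
  by rewrite yz xz (eq_sym y) xy.
by rewrite bE; apply/setP => f; rewrite !inE [[set y; x]]setUC; do 3 case: (_ == _).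
Qed.

Lemma triface_sz t x y z : triface t x y z -> nsides t = 3.
Proof. by case=> /and3P[xy yz xz] _ e; rewrite /nsides e card_triangle. Qed.

Lemma triface_xy t x y z : triface t x y z -> [set x; y] \in sides t.
Proof. by case=> _ _ ->; rewrite !inE eqxx. Qed.
Lemma triface_yz t x y z : triface t x y z -> [set y; z] \in sides t.
Proof. by move=> /triface_rot/triface_xy. Qed.
Lemma triface_xz t x y z : triface t x y z -> [set x; z] \in sides t.
Proof. by move=> /triface_swap/triface_yz. Qed.

Lemma triface_mem t x y z f : triface t x y z ->
  (f \in sides t) = (f == [set x; y]) (+) (f == [set y; z]) (+) (f == [set x; z]).
Proof.
case=> /and3P[xy yz xz] _ ->; rewrite !inE.
case: (eqVneq f [set x; y]) => [->|_].
  by rewrite !eq_set2 (negbTE yz) (negbTE xz) (negbTE xy) !andbF.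
case: (eqVneq f [set y; z]) => [->|_] //=.
by rewrite !eq_set2 (eq_sym y x) (negbTE xy) (negbTE yz).
Qed.

Lemma trifaceP t x y : nsides t = 3 -> [set x; y] \in sides t -> exists z, triface t x y z.
Proof.
move=> s3 xyt.
have [z [zx zy bE]] := even_triangle (@sides_simple t) (sides_even t) s3 xyt.
exists z; split=> //; last exact: sides_face xyt.
by rewrite (edge_neq sE (sides_sub xyt)) !(eq_sym _ z) zx zy.
Qed.

Lemma triface_apex t x y z c : triface t x y z -> [set x; c] \in sides t -> c != y -> c = z.
Proof.
move=> tf; rewrite (triface_mem _ tf); case: tf => /and3P[xy yz xz] _ _.
rewrite !eq_set2 eqxx (negbTE xy) (negbTE xz) /= => + cy.
by rewrite (negbTE cy) ?orbF /= => /eqP.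
Qed.

Definition ntri f : nat := (nsides (l f) == 3) + (nsides (r f) == 3).

Lemma ntri2 f i j : f \in sides i -> f \in sides j -> i != j -> nsides i = 3 -> nsides j = 3 ->
  ntri f = 2.
Proof.
move=> fi fj ij si sj; have fE := sides_sub fi.
have := sides_ends fi fj ij => /eqP; rewrite eq_set2 /ntri.
by case/orP => /andP[/eqP-> /eqP->]; rewrite si sj.
Qed.

Lemma ntri2_other f t : f \in sides t -> ntri f = 2 ->
  exists t', [/\ t' != t, f \in sides t' & nsides t' = 3].
Proof.
move=> ft t2; have [j jt fj] := sides_other ft; exists j; split=> //.
have := sides_ends fj ft jt => /eqP; rewrite eq_set2 /ntri in t2 *.
by case/orP=> /andP[/eqP e1 /eqP e2]; move: t2; rewrite e1 e2; do 2 case: eqP.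
Qed.

Lemma ntri0 f i : ntri f = 0 -> f \in sides i -> nsides i != 3.
Proof.
move=> + fi; have fE := sides_sub fi; move: fi; rewrite sidesE // /ntri.
by case/orP => /eqP <-; do 2 case: (_ == 3).
Qed.

Lemma ntri_pos f : f \in E -> 0 < ntri f -> exists2 t, f \in sides t & nsides t = 3.
Proof.
move=> fE; rewrite /ntri; case: (eqVneq (nsides (l f)) 3) => [e _|_].
  by exists (l f); rewrite // sidesE // eqxx.
by case: (eqVneq (nsides (r f)) 3) => [e _|//]; exists (r f); rewrite // sidesE // eqxx orbT.
Qed.

Lemma ntri1_other f t j : f \in sides t -> nsides t = 3 -> ntri f != 2 -> f \in sides j ->
  j != t -> nsides j != 3.
Proof.
move=> ft s3 t2 fj jt; apply: contra t2 => /eqP sj; apply/eqP.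
exact: ntri2 fj ft jt sj s3.
Qed.

(** A pentagon appears if the apex of the triangle is off the quadrangle. Otherwise
the triangle and the quadrangle share two sides, and [parallel_edges] applies at
their common end. *)
Lemma no_triangle_quadrangle t q x y z : triface t x y z -> nsides q = 4 ->
  [set x; y] \in sides q -> False.
Proof.
move=> tf s4 xyq; have tq : t != q by apply/eqP => e; move: s4; rewrite -e (triface_sz tf).
have [p [s [U bE]]] := even_C4 (@sides_simple q) (sides_even q) s4 xyq.
have [/and3P[xy yz xz] _ _] := tf.
have inq f : f \in [:: [set x; y]; [set y; p]; [set p; s]; [set s; x]] -> f \in sides q.
  by move=> ?; rewrite bE inE.
have e2 : [set y; p] \in sides q by apply: inq; rewrite !inE eqxx !orbT.
have e3 : [set p; s] \in sides q by apply: inq; rewrite !inE eqxx !orbT.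
have e4 : [set s; x] \in sides q by apply: inq; rewrite !inE eqxx !orbT.
have [xV yV] := edge_ends EV (sides_sub xyq).
case: (eqVneq z p) => [zp|zp].
  have [c [ycE cx cz]] := third_edge x z yV.
  have yx : [set y; x] \in sides t by rewrite setUC (triface_xy tf).
  have yxq : [set y; x] \in sides q by rewrite setUC.
  have yzq : [set y; z] \in sides q by rewrite zp.
  apply: (parallel_edges sE EV conn dualE (sides_sub yx) (sides_sub yzq) ycE xz cx cz).
  by rewrite (sides_ends yx yxq tq) (sides_ends (triface_yz tf) yzq tq).
case: (eqVneq z s) => [zs|zs].
  have [c [xcE cy cz]] := third_edge y z xV.
  have xzq : [set x; z] \in sides q by rewrite zs setUC.
  apply: (parallel_edges sE EV conn dualE (sides_sub xyq) (sides_sub xzq) xcE yz cy cz).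
  by rewrite (sides_ends (triface_xy tf) xyq tq) (sides_ends (triface_xz tf) xzq tq).
apply: (@noC5 x z y p s).
- move: U; rewrite /= !inE !negb_or xz xy (eq_sym z y) yz zp zs -!andbA.
  by case/and5P => _ -> -> -> /andP[-> ->].
- exact: sides_sub (triface_xz tf).
- by rewrite setUC; exact: sides_sub (triface_yz tf).
- exact: sides_sub e2.
- exact: sides_sub e3.
- exact: sides_sub e4.
Qed.

Lemma quad_ntri0 f q : f \in sides q -> nsides q = 4 -> ntri f = 0.
Proof.
move=> fq s4; apply/eqP; rewrite -leqn0 leqNgt; apply/negP.
move=> /(ntri_pos (sides_sub fq))[t ft s3].
have /eqP/cards2P[x [y [xy ef]]] := sE (sides_sub fq); subst f.
by have [z tf] := trifaceP s3 ft; exact: no_triangle_quadrangle tf s4 fq.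
Qed.

(** Two triangular faces with the same sides would form a component of the dual. *)
Lemma triface_apex_neq t t' x y z w : triface t x y z -> triface t' x y w -> t != t' ->
  w != z.
Proof.
move=> tf tf' tt; apply/eqP => wz; subst w.
have [_ tF _] := tf; have [_ tF' _] := tf'.
have /negP[] : cut E l r (symdiff [set t] [set t']) != set0.
  apply: few_faces.
  - by apply/subsetP => i; rewrite !inE; case: eqVneq => [->//|_ /=] /eqP->.
  - by apply/set0Pn; exists t; rewrite !inE eqxx (negbTE tt).
  - have := card_symdiff [set t] [set t']; rewrite !cards1; lia.
rewrite cut_symdiff -/(sides t) -/(sides t'); apply/eqP/setP => f.
by rewrite mem_symdiff in_set0 (triface_mem _ tf) (triface_mem _ tf') addbb.
Qed.

(** Distinct apexes give the pentagon x, a, y, b, z. *)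
Lemma triface_fan t t1 t2 x y z a b : triface t x y z -> triface t1 x y a ->
  triface t2 y z b -> t != t1 -> t != t2 -> a = b.
Proof.
move=> tf tf1 tf2 n1 n2; apply/eqP; apply: contraT => ab.
have az := triface_apex_neq tf tf1 n1.
have bx := triface_apex_neq (triface_rot tf) tf2 n2.
have [/and3P[xy yz xz] _ _] := tf.
have [/and3P[_ ya xa] _ _] := tf1; have [/and3P[_ zb yb] _ _] := tf2.
have : False; last by [].
apply: (@noC5 x a y b z).
- rewrite /= !inE !negb_or xa xy (eq_sym x b) bx xz (eq_sym a y) ya ab az.
  by rewrite yb yz (eq_sym b z) zb.
- exact: sides_sub (triface_xz tf1).
- by rewrite setUC; exact: sides_sub (triface_yz tf1).
- exact: sides_sub (triface_xz tf2).
- by rewrite setUC; exact: sides_sub (triface_yz tf2).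
- by rewrite setUC; exact: sides_sub (triface_xz tf).
Qed.

(** By [triface_fan] the three neighbours of the triangle have the same apex: these
four faces are the faces of a K4 and form a component of the dual. *)
Lemma three_ntri2 t x y z : triface t x y z -> ntri [set x; y] = 2 ->
  ntri [set y; z] = 2 -> ntri [set x; z] = 2 -> False.
Proof.
move=> tf e1 e2 e3.
have [t1 [n1 xy1 s1]] := ntri2_other (triface_xy tf) e1.
have [t2 [n2 yz2 s2]] := ntri2_other (triface_yz tf) e2.
have [t3 [n3 xz3 s3]] := ntri2_other (triface_xz tf) e3.
have [a f1] := trifaceP s1 xy1; have [b f2] := trifaceP s2 yz2.
have [c f3] := trifaceP s3 xz3.
have ab : a = b by apply: (triface_fan tf f1 f2); rewrite eq_sym.
have bc : b = c.
  by apply: (triface_fan (triface_rot tf) f2 (triface_swap f3)); rewrite eq_sym.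
subst b c; have [_ tF _] := tf; have [_ t1F _] := f1.
have [_ t2F _] := f2; have [_ t3F _] := f3.
(* The four faces are distinct, but oddness is all that matters here: each of
   the six edges of the K4 is on two of them. *)
pose A := symdiff (symdiff [set t] [set t1]) (symdiff [set t2] [set t3]).
have /negP[] : cut E l r A != set0.
  apply: few_faces.
  - apply/subsetP => i; rewrite !inE.
    case: (eqVneq i t) => [->//|_]; case: (eqVneq i t1) => [->//|_].
    by case: (eqVneq i t2) => [->//|_]; case: (eqVneq i t3) => [->//|_].
  - apply/set0Pn; exists t; rewrite !inE eqxx (eq_sym t) (negbTE n1).
    by rewrite (eq_sym t) (negbTE n2) (eq_sym t) (negbTE n3).
  - rewrite ltnS; apply: leq_trans (card_symdiff_le _ _) _.
    by apply: (@leq_add _ _ 2 2); apply: leq_trans (card_symdiff_le _ _) _;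
      rewrite !cards1.
rewrite !cut_symdiff -!/(sides _); apply/eqP/setP => f.
rewrite !mem_symdiff in_set0 (triface_mem _ tf) (triface_mem _ f1) (triface_mem _ f2).
rewrite (triface_mem _ f3).
rewrite [[set z; a]]setUC.
by do 6 case: (f == _).
Qed.

Lemma triface_sum t x y z (G : {set T} -> nat) : triface t x y z ->
  \sum_(f in sides t) G f = G [set x; y] + G [set y; z] + G [set x; z].
Proof.
move=> tf; case: (tf) => /and3P[xy yz xz] _ bE.
rewrite (eq_bigl (mem [:: [set x; y]; [set y; z]; [set x; z]])); last first.
  by move=> f; rewrite bE !inE orbA.
rewrite -big_uniq /=; first by rewrite !big_cons big_nil addn0 addnA.
rewrite !inE !eq_set2 !negb_or (negbTE yz) (negbTE xz) (negbTE xy).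
by rewrite (eq_sym y x) (negbTE xy) !andbF.
Qed.

Definition nshared t : nat := #|[set f in sides t | ntri f == 2]|.

Lemma nsharedE t x y z : triface t x y z ->
  nshared t = (ntri [set x; y] == 2) + (ntri [set y; z] == 2) + (ntri [set x; z] == 2).
Proof.
move=> tf; rewrite -(triface_sum (fun f => ntri f == 2 : nat) tf) /nshared -sum1_card.
by rewrite [RHS]big_mkcond [LHS]big_mkcond; apply: eq_bigr => f _;
  rewrite inE; case: (f \in sides t) => //=; case: eqP.
Qed.

Definition on_face v t : bool := [exists f in sides t, v \in f].

Lemma on_face_edge v t f : f \in sides t -> v \in f -> on_face v t.
Proof. by move=> ft vf; apply/existsP; exists f; rewrite ft. Qed.

Lemma on_faceE t x y z v : triface t x y z -> on_face v t = (v \in [:: x; y; z]).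
Proof.
move=> tf; apply/idP/idP => [/exists_inP[f]|].
  case: tf => _ _ ->; rewrite !inE => /orP[/orP[]|] /eqP ->; rewrite !inE;
  by case/orP => ->; rewrite ?orbT.
rewrite !inE => /or3P[] /eqP ->.
- by apply: on_face_edge (triface_xy tf) _; rewrite !inE eqxx.
- by apply: on_face_edge (triface_yz tf) _; rewrite !inE eqxx.
- by apply: on_face_edge (triface_yz tf) _; rewrite !inE eqxx orbT.
Qed.

Lemma on_face_sum t x y z (G : T -> nat) : triface t x y z ->
  \sum_(v | on_face v t) G v = G x + G y + G z.
Proof.
move=> tf; rewrite (eq_bigl (mem [:: x; y; z])) => [|v]; last exact: on_faceE tf.
case: (tf) => /and3P[xy yz xz] _ _.
rewrite -big_uniq /=; first by rewrite !big_cons big_nil addn0 addnA.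
by rewrite !inE negb_or xy xz yz.
Qed.

(** What the triangle t collects from its sides is passed on to its vertices. A triangle
with s shared sides distributes 156 - 48 * s: equally when s is 0 or 1, while for
s = 2 the vertex common to the two shared sides gets 24 and the other ones 18. *)
Definition share v t : nat :=
  if nshared t == 0 then 52 else if nshared t == 1 then 36 else
  if [forall f in sides t, (v \in f) ==> (ntri f == 2)] then 24 else 18.

Lemma share_center t x y z : triface t x y z ->
  [forall f in sides t, (x \in f) ==> (ntri f == 2)] =
  (ntri [set x; y] == 2) && (ntri [set x; z] == 2).
Proof.
move=> tf; case: (tf) => /and3P[xy yz xz] _ bE; apply/idP/idP.
  move/forall_inP => h; have := h _ (triface_xy tf); have := h _ (triface_xz tf).
  by rewrite !inE eqxx /= => -> ->.
case/andP=> h1 h2; apply/forall_inP => f; rewrite bE !inE => /orP[/orP[]|] /eqP->.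
- by rewrite h1 implybT.
- by rewrite !inE (negbTE xy) (negbTE xz).
- by rewrite h2 implybT.
Qed.

Lemma share_ge18 v t : 18 <= share v t.
Proof. by rewrite /share; do ?case: ifP. Qed.

Lemma share_ge36 v t : nshared t <= 1 -> 36 <= share v t.
Proof. by rewrite /share; case: (nshared t) => [|[|]]. Qed.

Lemma share_sum t : nsides t = 3 -> \sum_(v | on_face v t) share v t + 48 * nshared t <= 156.
Proof.
move=> s3; have /set0Pn[f ft] : sides t != set0 by rewrite -card_gt0 -/(nsides t) s3.
have /eqP/cards2P[x [y [xy ef]]] := sE (sides_sub ft); subst f.
have [z tf] := trifaceP s3 ft; rewrite (on_face_sum _ tf) /share.
rewrite (share_center tf) (share_center (triface_rot tf)).
rewrite (share_center (triface_rot (triface_rot tf))) (nsharedE tf).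
rewrite [[set z; x]]setUC [[set y; x]]setUC [[set z; y]]setUC.
have := three_ntri2 tf.
case: (eqVneq (ntri [set x; y]) 2) => [->|_]; case: (eqVneq (ntri [set y; z]) 2) => [->|_];
  case: (eqVneq (ntri [set x; z]) 2) => [->|_] //=.
by case.
Qed.

(** The charge that an edge receives from a face of size k on one of its sides. An
edge between faces of sizes a and b has weight 46 - 132 / a + 46 - 132 / b when the
sizes above 6 are counted as 6. *)
Definition side_weight k : nat := if k == 3 then 2 else if k == 4 then 13 else 24.
Definition weight f : nat := side_weight (nsides (l f)) + side_weight (nsides (r f)).

Lemma weight_ge26 f : ntri f = 0 -> 26 <= weight f.
Proof. by rewrite /ntri /weight /side_weight; do 2 case: (_ == 3) => //; do 2 case: (_ == 4). Qed.

Lemma sum_seq_le (J : finType) (P : pred J) (G : J -> nat) (s : seq J) :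
  uniq s -> all P s -> \sum_(j <- s) G j <= \sum_(j | P j) G j.
Proof.
move=> us /allP sP; rewrite big_uniq // [X in _ <= X](bigID (mem s)) /=.
apply: leq_trans (leq_addr _ _); rewrite (eq_bigl (fun j => P j && (j \in s))) //.
by move=> j /=; case: (boolP (j \in s)) => [/sP ->|]; rewrite ?andbF.
Qed.

Definition triangles_at v : pred I := fun t => (nsides t == 3) && on_face v t.
Definition triangle_income v : nat := \sum_(t | triangles_at v t) share v t.
Definition edge_income v : nat := \sum_(f | (f \in star E v) && (ntri f == 0)) weight f.

Lemma triangle_income_ge v s : uniq s -> all (triangles_at v) s -> \sum_(t <- s) share v t <= triangle_income v.
Proof. exact: sum_seq_le. Qed.

Lemma edge_income_ge v s : uniq s -> all (fun f => (f \in star E v) && (ntri f == 0)) s ->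
  \sum_(f <- s) weight f <= edge_income v.
Proof. exact: sum_seq_le. Qed.

Lemma in_star v c : ([set v; c] \in star E v) = ([set v; c] \in E).
Proof. by rewrite !inE eqxx andbT. Qed.

Lemma corner_third t v f : nsides t = 3 -> f \in sides t -> v \in f ->
  exists a b, triface t v a b /\ f = [set v; a].
Proof.
move=> s3 ft vf; have [a _ ef] := edgeP sE (sides_sub ft) vf; subst f.
by have [b tf] := trifaceP s3 ft; exists a, b.
Qed.

(** The triangles s at v already give half of what v needs. The edge g off these
triangles gives the other half: alone if it has a long face, together with the
next edge of a quadrangle if both its faces are quadrangles, and through one or
two further triangles otherwise. *)
Lemma extra_edge v s g :
    uniq s -> all (triangles_at v) s -> 36 <= \sum_(t <- s) share v t ->
    g \in star E v -> (forall t, t \in s -> g \notin sides t) ->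
    (forall t t' f, t \in s -> f \in star E v -> f \in sides t -> ntri f = 2 ->
      f \in sides t' -> nsides t' = 3 -> t' \in s) ->
  72 <= triangle_income v + edge_income v.
Proof.
move=> us sv k36 gv gs closed.
have [gE vg] : g \in E /\ v \in g by move: gv; rewrite inE => /andP.
have [c cv eg] := edgeP sE gE vg.
case: (posnP (ntri g)) => [g0|gpos].
  have Q1s := leq_trans k36 (triangle_income_ge us sv).
  case: (leqP 36 (weight g)) => vl.
    have : \sum_(f <- [:: g]) weight f <= edge_income v by apply: edge_income_ge; rewrite //= gv g0.
    rewrite big_cons big_nil addn0 => h.
    by apply: (@leq_add 36 36) => //; exact: leq_trans vl h.
  have s4 : nsides (l g) = 4.
    move: g0 vl; rewrite /ntri /weight /side_weight; do 2 case: (_ == 3) => //.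
    by case: eqP => //; case: eqP.
  have gl : g \in sides (l g) by rewrite sidesE // eqxx.
  have cvl : [set c; v] \in sides (l g) by rewrite setUC -eg.
  have [z [zc zv vz]] := even_next (@sides_simple _) (sides_even _) cvl.
  have gz : g != [set v; z].
    by rewrite eg eq_set2 eqxx (eq_sym c) (negbTE zc) (negbTE cv) !andbF.
  have z0 := quad_ntri0 vz s4.
  have : \sum_(f <- [:: g; [set v; z]]) weight f <= edge_income v.
    by apply: edge_income_ge; [rewrite /= inE gz | rewrite /= gv g0 in_star (sides_sub vz) z0].
  rewrite !big_cons big_nil addn0 => h; apply: (@leq_add 36 36) => //.
  apply: leq_trans h; apply: (@leq_trans (26 + 26)) => //.
  by apply: leq_add; apply: weight_ge26.
have [t3 gt3 s3] := ntri_pos gE gpos.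
have t3s : t3 \notin s by apply/negP => /gs; rewrite gt3.
have t3v : triangles_at v t3 by rewrite /triangles_at s3 eqxx (on_face_edge gt3 vg).
case: (leqP (nshared t3) 1) => sh3.
  have : \sum_(t <- t3 :: s) share v t <= triangle_income v.
    by apply: triangle_income_ge; rewrite /= ?t3s ?t3v.
  rewrite big_cons => h; apply: leq_trans (leq_addr _ _).
  by apply: leq_trans h; apply: (@leq_add 36 36) => //; exact: share_ge36.
have [h [hv ht h2]] : exists h, [/\ h \in star E v, h \in sides t3 & ntri h = 2].
  have [a [b [tf eg']]] := corner_third s3 gt3 vg.
  move: sh3; rewrite (nsharedE tf).
  case: (eqVneq (ntri [set v; a]) 2) => [e _|_].
    by exists [set v; a]; rewrite in_star (sides_sub (triface_xy tf)); split=> //; exact: triface_xy tf.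
  case: (eqVneq (ntri [set v; b]) 2) => [e _|_]; last by case: (_ == 2).
  by exists [set v; b]; rewrite in_star (sides_sub (triface_xz tf)); split=> //; exact: triface_xz tf.
have [t4 [t43 ht4 s4]] := ntri2_other ht h2.
have t4s : t4 \notin s.
  by apply/negP => t4s; move/negP: t3s; apply; apply: (closed t4 t3 h).
have t4v : triangles_at v t4.
  rewrite /triangles_at s4 eqxx; apply: on_face_edge ht4 _.
  by move: hv; rewrite inE => /andP[].
have : \sum_(t <- t4 :: t3 :: s) share v t <= triangle_income v.
  by apply: triangle_income_ge; rewrite /= ?t3v ?t4v // inE negb_or t43 t4s t3s.
rewrite !big_cons addnA => kq; apply: leq_trans (leq_addr _ _).
apply: leq_trans kq; apply: (@leq_add 36 36) => //.
by apply: (@leq_add 18 18); exact: share_ge18.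
Qed.

(** Three triangles meet at y and each of them gives 24. *)
Lemma center_ge72 t x y z : triface t x y z -> ntri [set x; y] = 2 ->
  ntri [set y; z] = 2 -> 72 <= triangle_income y.
Proof.
move=> tf e1 e2.
have [t1 [n1 xy1 s1]] := ntri2_other (triface_xy tf) e1.
have [t2 [n2 yz2 s2]] := ntri2_other (triface_yz tf) e2.
have [a f1] := trifaceP s1 xy1; have [b f2] := trifaceP s2 yz2.
have ab : a = b by apply: (triface_fan tf f1 f2); rewrite eq_sym.
subst b.
have az : a != z by apply: (triface_apex_neq tf f1); rewrite eq_sym.
have n12 : t1 != t2.
  apply/eqP => e; subst t2.
  have := triface_apex (triface_swap f1) yz2.
  have [/and3P[_ _ xz] _ _] := tf.
  by rewrite eq_sym xz => /(_ isT) za; rewrite za eqxx in az.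
have ya2 : ntri [set y; a] = 2.
  exact: (ntri2 (triface_yz f1) (triface_xz f2) n12 s1 s2).
have k24 t' b c : triface t' y b c -> ntri [set y; b] = 2 -> ntri [set y; c] = 2 ->
    24 <= share y t'.
  move=> tf' h1 h2; rewrite /share (share_center tf') h1 h2 /=.
  by do ?case: ifP.
have : \sum_(t' <- [:: t; t1; t2]) share y t' <= triangle_income y.
  apply: triangle_income_ge; rewrite /= ?inE ?negb_or.
    by rewrite n12 !(eq_sym t) n1 n2.
  rewrite /triangles_at (triface_sz tf) s1 s2 !eqxx (on_faceE _ tf) (on_faceE _ f1).
  by rewrite (on_faceE _ f2) !inE eqxx !orbT.
rewrite !big_cons big_nil.
apply: leq_trans; rewrite addn0; rewrite setUC in e1.
apply: (@leq_add 24 48); first exact: k24 (triface_swap tf) e1 e2.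
apply: (@leq_add 24 24); last exact: k24 f2 e2 ya2.
exact: k24 (triface_swap f1) e1 ya2.
Qed.

(** By [triface_fan] a third triangle next to t' has the same apex as t, hence is
next to t too. *)
Lemma nshared_pair t t' x y z w : triface t x y z -> triface t' x y w -> t != t' ->
  1 < nshared t' -> 1 < nshared t.
Proof.
move=> tf tf' tt; have tt' : t' != t by rewrite eq_sym.
have e2 : ntri [set x; y] = 2.
  exact: ntri2 (triface_xy tf) (triface_xy tf') tt (triface_sz tf) (triface_sz tf').
rewrite (nsharedE tf) (nsharedE tf') e2 /=.
have step x1 y1 : triface t x1 y1 z -> triface t' x1 y1 w -> ntri [set y1; w] = 2 ->
    ntri [set y1; z] = 2.
  move=> g g' h2; have [t2 [n2 yw2 s2]] := ntri2_other (triface_yz g') h2.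
  have [b f2] := trifaceP s2 yw2.
  have bz : z = b by apply: (triface_fan g' g f2) => //; rewrite eq_sym.
  subst b; apply: (ntri2 (triface_yz g) (triface_xz f2) _ (triface_sz g) s2).
  apply/eqP => e; subst t2; have [/and3P[_ wz _] _ _] := f2.
  have [/and3P[_ _ xw] _ _] := g'.
  have := triface_apex (triface_swap g) (triface_xy f2).
  by rewrite eq_sym => /(_ xw) e; rewrite e eqxx in wz.
case: (eqVneq (ntri [set y; w]) 2) => [/(step x y tf tf')->//|_].
case: (eqVneq (ntri [set x; w]) 2) => [|_ //].
by move/(step y x (triface_swap tf) (triface_swap tf')) => ->; case: (_ == 2).
Qed.

(** The faces t, t' and t3 surround z and fill the triangle v, u, w, two sides of
which are on the long face i. *)
Definition corner_at v u w i : Prop := exists z t t' t3,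
  [/\ triface t v z u, triface t' v z w, triface t3 z u w &
   [/\ 6 <= nsides i, [set v; u] \in sides i & [set v; w] \in sides i]].

Definition short_corner v i : Prop := exists u w, corner_at v u w i.

Lemma two_shares_le v t t' : t != t' -> triangles_at v t -> triangles_at v t' ->
  share v t + share v t' <= triangle_income v.
Proof.
move=> tt h h'; have : \sum_(t'' <- [:: t; t']) share v t'' <= triangle_income v.
  by apply: triangle_income_ge; rewrite /= ?inE ?tt ?h ?h'.
by rewrite !big_cons big_nil addn0.
Qed.

Lemma triface_at t x y z : triface t x y z -> triangles_at x t.
Proof. by move=> tf; rewrite /triangles_at (triface_sz tf) (on_faceE _ tf) inE !eqxx. Qed.

(** Case analysis on the edges at v. If one of them is shared by two triangles, then
either these two triangles give 36 each, or v is the centre of three triangles, or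
v is the corner of three triangles, which give 36, and there is another edge at v
unless v is a short corner. If no edge at v is shared but v is on a triangle, this
triangle gives at least 36 and [extra_edge] applies to a third edge. Otherwise the
edges at v, at least three, give at least 26 each. *)
Lemma vertex_charge v : v \in V ->
  72 <= triangle_income v + edge_income v \/ 36 <= triangle_income v /\ exists i, short_corner v i.
Proof.
move=> vV; case: (boolP [exists f in star E v, ntri f == 2]).
  move=> /exists_inP[f]; rewrite inE => /andP[fE vf] /eqP f2.
  have [||t ft s3] := @ntri_pos f; rewrite ?f2 //.
  have [z [u [tf ef]]] := corner_third s3 ft vf; subst f.
  have [t' [tt vz' s3']] := ntri2_other ft f2.
  have [w tf'] := trifaceP s3' vz'.
  have tt' : t != t' by rewrite eq_sym.
  have k2 := two_shares_le tt' (triface_at tf) (triface_at tf').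
  case: (leqP (nshared t) 1) => sh1.
    left; apply: leq_trans (leq_addr _ _); apply: leq_trans k2.
    apply: (@leq_add 36 36); apply: share_ge36 => //.
    by rewrite leqNgt; apply/negP => /(nshared_pair tf tf' tt'); rewrite ltnNge sh1.
  case: (eqVneq (ntri [set v; u]) 2) => [vu2|vu2].
    left; apply: leq_trans (leq_addr _ _).
    by apply: (center_ge72 (triface_swap tf) _ vu2); rewrite setUC.
  have zu2 : ntri [set z; u] = 2.
    by move: sh1; rewrite (nsharedE tf) f2 (negbTE vu2) addn0 /=; case: eqP.
  have [t3 [tt3 zu3 s33]] := ntri2_other (triface_yz tf) zu2.
  have [w' tf3] := trifaceP s33 zu3.
  have e : w = w' by apply: (triface_fan tf tf' tf3); rewrite // eq_sym.
  subst w'.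
  have uw := triface_apex_neq tf tf' tt'.
  have t3t' : t3 != t'.
    apply/eqP => e3; subst t3; have := triface_apex (triface_swap tf') zu3.
    have [/and3P[_ _ vu] _ _] := tf; rewrite eq_sym => /(_ vu) e.
    by rewrite e eqxx in uw.
  have zw2 : ntri [set z; w] = 2.
    exact: ntri2 (triface_xz tf3) (triface_yz tf') t3t' s33 s3'.
  have vw2 : ntri [set v; w] != 2.
    by apply/eqP => /(three_ntri2 tf' f2 zw2).
  case: (boolP [exists g in star E v, g \notin [set [set v; z]; [set v; u]; [set v; w]]]).
    case/exists_inP => g gv; rewrite !inE !negb_or -andbA => /and3P[gz gu gw].
    left; apply: (@extra_edge v [:: t; t'] g) => //.
    - by rewrite /= inE tt'.
    - by rewrite /= (triface_at tf) (triface_at tf').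
    - by rewrite !big_cons big_nil addn0; apply: (@leq_add 18 18); exact: share_ge18.
    - move: gv; rewrite inE => /andP[gE vg]; have [c cv ec] := edgeP sE gE vg.
      subst g; move: gz gu gw; rewrite !eq_set2 !eqxx /= !negb_or.
      move=> /andP[cz _] /andP[cu _] /andP[cw _].
      move=> t''; rewrite in_cons mem_seq1 => /orP[]/eqP->; apply/negP.
        by move/(triface_apex tf)/(_ cz) => e; rewrite e eqxx in cu.
      by move/(triface_apex tf')/(_ cz) => e; rewrite e eqxx in cw.
    - move=> t1 t2 h ht1; rewrite inE => /andP[hE vh] h1 h2 ht2 _.
      have hz : h = [set v; z].
        have [c cv ec] := edgeP sE hE vh; subst h.
        move: ht1; rewrite !inE => /orP[]/eqP e; subst t1.
          case: (eqVneq c z) => [->//|cz]; have e := triface_apex tf h1 cz.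
          by rewrite -e h2 in vu2.
        case: (eqVneq c z) => [->//|cz]; have e := triface_apex tf' h1 cz.
        by rewrite -e h2 in vw2.
      subst h; rewrite !inE.
      by have [->|->] := sides_two ft vz' tt' ht2; rewrite eqxx ?orbT.
  rewrite negb_exists => /forallP only.
  right; split.
    by apply: leq_trans k2; apply: (@leq_add 18 18); exact: share_ge18.
  (* The other face of vu continues, at v, with vw: v has no other edge and vz
     only lies on t and t'. *)
  have [i it vui] := sides_other (triface_xz tf).
  have uvi : [set u; v] \in sides i by rewrite setUC.
  have [c [cu cv vci]] := even_next (@sides_simple _) (sides_even _) uvi.
  have vcE : [set v; c] \in star E v by rewrite in_star (sides_sub vci).
  have cw : c = w.
    move: (only [set v; c]); rewrite vcE /= negbK !inE !eq_set2 !eqxx.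
    have nv d : (v == d) && (c == v) = false by rewrite (negbTE cv) andbF.
    rewrite !nv !orbF /= (negbTE cu) orbF => /orP[]/eqP // cz; subst c.
    have [e|e] := sides_two ft vz' tt' vci; first by rewrite e eqxx in it.
    subst i; have [/and3P[_ zu _] _ _] := tf.
    have := triface_apex tf' vui; rewrite eq_sym => /(_ zu) e.
    by rewrite e eqxx in uw.
  subst c; exists i, u, w, z, t, t', t3; split=> //; split=> //.
  have iF := sides_face vui.
  have s3i : nsides i != 3 by apply: (ntri1_other (triface_xz tf)).
  case: (nsides_cases iF) => // s4; first by rewrite s4 in s3i.
  have := quad_ntri0 vui s4; rewrite /ntri => e0.
  by have := ntri0 e0 (triface_xz tf); rewrite s3.
rewrite negb_exists => /forallP no2; left.
have no2' f : f \in star E v -> ntri f != 2 by move=> fv; have := no2 f; rewrite fv.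
case: (boolP [exists f in star E v, ntri f != 0]).
  case/exists_inP => f; rewrite inE => /andP[fE vf] f0.
  have [||t ft s3] := @ntri_pos f; rewrite ?lt0n //.
  have [a [b [tf ef]]] := corner_third s3 ft vf; subst f.
  have [c [vcE ca cb]] := third_edge a b vV.
  apply: (@extra_edge v [:: t] [set v; c]) => //.
  - by rewrite /= (triface_at tf).
  - rewrite big_cons big_nil addn0; apply: share_ge36; rewrite (nsharedE tf).
    have := no2' _ (_ : [set v; a] \in star E v); rewrite in_star => /(_ fE)/negbTE->.
    have := no2' _ (_ : [set v; b] \in star E v).
    by rewrite in_star => /(_ (sides_sub (triface_xz tf)))/negbTE->; case: (_ == 2).
  - by rewrite in_star.
  - move=> t'; rewrite mem_seq1 => /eqP->; apply/negP => /(triface_apex tf)/(_ ca) e.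
    by rewrite e eqxx in cb.
  - by move=> t1 t2 f _ fv _ h2; have := no2' f fv; rewrite h2.
rewrite negb_exists => /forallP no1.
have no1' f : f \in star E v -> ntri f = 0.
  by move=> fv; have := no1 f; rewrite fv negbK => /eqP.
apply: leq_trans (leq_addl _ _); rewrite /edge_income.
rewrite (eq_bigl (mem (star E v))) => [|f]; last first.
  case: (boolP (f \in star E v)) => [fv|/negbTE nfv].
    by rewrite (no1' f fv) /= fv.
  by rewrite /= nfv.
apply: (@leq_trans (\sum_(f in star E v) 26)).
  rewrite sum_nat_const; apply: (@leq_trans (3 * 26)) => //.
  by apply: leq_mul => //; exact: mindeg.
by apply: leq_sum => f fv; exact: weight_ge26 (no1' f fv).
Qed.

Lemma corner_faces_neq v z u w t t' t3 : triface t v z u -> triface t' v z w ->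
  triface t3 z u w -> [&& t != t', t != t3 & t' != t3].
Proof.
move=> tf tf' tf3; have [/and3P[vz zu vu] _ _] := tf.
have [/and3P[_ zw vw] _ _] := tf'; have [/and3P[_ uw _] _ _] := tf3.
apply/and3P; split; apply/eqP => e; subst.
- have := triface_apex tf (triface_xz tf'); rewrite eq_sym => /(_ zw) e.
  by rewrite e eqxx in uw.
- have := triface_apex (triface_swap tf) (triface_xz tf3).
  rewrite eq_sym => /(_ vw) e; by rewrite e eqxx in uw.
- have := triface_apex (triface_swap tf') (triface_xy tf3).
  rewrite eq_sym => /(_ vu) e; by rewrite e eqxx in uw.
Qed.

(** The three triangles around z have as cut the triangle v, u, w. If all of it were
on the face i, then i would separate these triangles from the other faces of the
dual, against [face_bond]. *)
Lemma short_corner_chord v i z u w t t' t3 : triface t v z u -> triface t' v z w ->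
  triface t3 z u w -> 6 <= nsides i -> [set v; u] \in sides i -> [set v; w] \in sides i ->
  [set u; w] \notin sides i.
Proof.
move=> tf tf' tf3 s6 vui vwi; apply/negP => uwi.
have /and3P[n1 n2 n3] := corner_faces_neq tf tf' tf3.
have [_ tF _] := tf; have [_ tF' _] := tf'; have [_ tF3 _] := tf3.
pose S := symdiff (symdiff [set t] [set t']) [set t3].
have inot j : nsides j = 3 -> i != j by move=> s3; apply: contraTneq s6 => ->; rewrite s3.
have SF : S \subset F.
  apply/subsetP => j; rewrite !inE; case: (eqVneq j t) => [->//|_].
  by case: (eqVneq j t') => [->//|_]; case: (eqVneq j t3) => [->//|_].
have S3 : #|S| <= 3.
  apply: leq_trans (card_symdiff_le _ _) _; rewrite cards1 addn1 ltnS.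
  by apply: leq_trans (card_symdiff_le _ _) _; rewrite !cards1.
have iS : i \notin S.
  by rewrite !inE !(negbTE (inot _ _)) ?(triface_sz tf) ?(triface_sz tf') ?(triface_sz tf3).
have iSF : i |: S != F.
  apply/eqP => e; have := many_faces; rewrite -e cardsU1 iS /= => h.
  by have := leq_trans h (leq_add (leqnn 1) S3).
have S0 : S != set0.
  by apply/set0Pn; exists t; rewrite !inE eqxx (negbTE n1) (negbTE n2).
have := face_bond sE EV conn dualE SF (sides_face vui) iS S0 iSF.
move=> /negP; apply; rewrite -/(sides i) /S !cut_symdiff -!/(sides _).
apply/subsetP => f; rewrite !mem_symdiff (triface_mem _ tf) (triface_mem _ tf').
rewrite (triface_mem _ tf3).
case: (eqVneq f [set v; u]) => [->//|_]; case: (eqVneq f [set v; w]) => [->//|_].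
case: (eqVneq f [set u; w]) => [->//|_].
by do 3 case: (_ == _).
Qed.

Lemma corner_at_sym v u w i : corner_at v u w i -> corner_at v w u i.
Proof.
case=> z [t [t' [t3 [tf tf' tf3 [s6 vu vw]]]]]; exists z, t', t, t3; split=> //.
exact: triface_swap (triface_rot (triface_rot tf3)).
Qed.

Lemma corner_at_chord v u w i : corner_at v u w i -> [set u; w] \notin sides i.
Proof.
by case=> z [t [t' [t3 [tf tf' tf3 [s6 vu vw]]]]]; exact: short_corner_chord tf tf' tf3 s6 vu vw.
Qed.

(** A common side would make v' equal to u, and the faces around z and z' the same;
then the three sides of the triangle would be on i. *)
Lemma corner_disjoint_side v u w v' u' w' i : corner_at v u w i ->
  corner_at v' u' w' i -> v != v' -> [set v; u] <> [set v'; u'].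
Proof.
move=> cv cv'; have chord := corner_at_chord cv.
case: cv cv' => z [t [t' [t3 [tf tf' tf3 [s6 vui vwi]]]]].
case=> z' [d [d' [d3 [df df' df3 [_ vui' vwi']]]]] vv' /eqP.
rewrite eq_set2 (negbTE vv') /= => /andP[/eqP e1 /eqP e2]; subst u' v'.
have [/and3P[vz zu vu] _ _] := tf; have [/and3P[uz' z'v uv] _ _] := df.
have [/and3P[_ zw vw] _ _] := tf'.
have /and3P[n1 n2 n3] := corner_faces_neq tf tf' tf3.
have /and3P[m1 m2 m3] := corner_faces_neq df df' df3.
have ti : t != i by apply: contraTneq s6 => <-; rewrite (triface_sz tf).
have di : d != i by apply: contraTneq s6 => <-; rewrite (triface_sz df).
have dvu : [set v; u] \in sides d by rewrite setUC (triface_xz df).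
have [e|e] := sides_two (triface_xz tf) vui ti dvu; last by rewrite e eqxx in di.
subst d.
have ez : z' = z.
  apply: (triface_apex (triface_rot (triface_swap tf))); rewrite 1?eq_sym //.
  by rewrite setUC (triface_yz df).
subst z'.
have d3vz : [set v; z] \in sides d3 by rewrite setUC (triface_xy df3).
have [e|e] := sides_two (triface_xy tf) (triface_xy tf') n1 d3vz.
  by rewrite e eqxx in m2.
subst d3.
have [/and3P[_ vw' _] _ _] := df3.
have e : w' = w by apply: (triface_apex (triface_swap tf') (triface_xz df3)); rewrite eq_sym.
by subst w'; rewrite vwi' in chord.
Qed.

(** The chord uw has a single triangular face, so both corners belong to the three
triangles around the same z. *)
Lemma corner_disjoint_chord v u w v' u' w' i : corner_at v u w i ->
  corner_at v' u' w' i -> v != v' -> [set u; w] <> [set u'; w'].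
Proof.
move=> cv cv'; have chord := corner_at_chord cv.
wlog: u' w' cv' / u = u' /\ w = w'.
  move=> H vv' e; move/eqP: (e); rewrite eq_set2 => /orP[]/andP[/eqP e1 /eqP e2].
    exact: (H u' w').
  by apply: (H w' u' (corner_at_sym cv')) => //; rewrite e setUC.
move=> [e1 e2] vv' _; subst u' w'.
case: cv cv' => z [t [t' [t3 [tf tf' tf3 [s6 vui vwi]]]]].
case=> z' [d [d' [d3 [df df' df3 [_ vui' vwi']]]]].
have /and3P[n1 n2 n3] := corner_faces_neq tf tf' tf3.
have /and3P[m1 m2 m3] := corner_faces_neq df df' df3.
have [/and3P[vz zu vu] _ _] := tf; have [/and3P[vz' zu' vu'] _ _] := df.
have d3t3 : d3 = t3.
  have [j jt3 uwj] := sides_other (triface_yz tf3).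
  have tj : ntri [set u; w] != 2.
    apply/eqP => e.
    apply: (three_ntri2 tf3 _ e _).
      exact: ntri2 (triface_yz tf) (triface_xy tf3) n2 (triface_sz tf) (triface_sz tf3).
    exact: ntri2 (triface_yz tf') (triface_xz tf3) n3 (triface_sz tf') (triface_sz tf3).
  apply/eqP; apply: contraT => ne.
  by have := ntri1_other (triface_yz tf3) (triface_sz tf3) tj (triface_yz df3) ne; rewrite (triface_sz df3).
subst d3.
have [/and3P[zu3 uw zw] _ _] := tf3; have [/and3P[_ _ z'w] _ _] := df3.
have ez : z' = z.
  apply: (triface_apex (triface_rot tf3) _ z'w).
  by rewrite setUC (triface_xy df3).
subst z'.
have [e|e] := sides_two (triface_yz tf) (triface_xy tf3) n2 (triface_yz df); last first.
  by rewrite e eqxx in m2.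
subst d.
have e : v' = v.
  apply: (triface_apex (triface_rot tf) _ vu').
  by rewrite setUC (triface_xy df).
by rewrite e eqxx in vv'.
Qed.

(** The sides vu and vw of the face are replaced by the chord uw, one corner v at a
time; the last property says that this leaves the other corners untouched. *)
Lemma shortcuts i (s : seq T) : uniq s -> (forall v, v \in s -> short_corner v i) ->
  exists D : {set {set T}}, [/\ D \subset E, even_set D, #|D| + size s = nsides i &
    forall v u w, corner_at v u w i -> v \notin s ->
      [/\ [set v; u] \in D, [set v; w] \in D & [set u; w] \notin D]].
Proof.
elim: s => [_ _|v s IHs /= /andP[vs us] sc].
  exists (sides i); rewrite addn0; split=> //; first exact: cut_sub.
    exact: sides_even.
  move=> v u w cv _; have := corner_at_chord cv.
  by case: cv => z [t [t' [t3 [_ _ _ []]]]].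
have [v' v's|D [DE eD cD memD]] := IHs us; first by apply: sc; rewrite inE v's orbT.
have [u [w cv]] : short_corner v i by apply: sc; rewrite inE eqxx.
have chord := corner_at_chord cv.
have [vuD vwD uwD] := memD _ _ _ cv vs.
have [z [t [t' [t3 [tf tf' tf3 [_ vui vwi]]]]]] := cv.
have [/and3P[_ _ vu] _ _] := tf; have [/and3P[_ _ vw] _ _] := tf'.
have [/and3P[_ uw _] _ _] := tf3.
pose R := [set [set v; u]; [set u; w]; [set v; w]].
have R2 : #|D :&: R| = 2.
  have -> : D :&: R = R :\ [set u; w].
    apply/setP => f; rewrite !in_setI !in_setD1 !in_setU !in_set1.
    case: (eqVneq f [set u; w]) => [->|_]; first by rewrite (negbTE uwD).
    rewrite orbF /=; case: (eqVneq f [set v; u]) => [->|_]; first by rewrite vuD.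
    by case: (eqVneq f [set v; w]) => [->|_]; rewrite ?vwD ?andbF.
  have := cardsD1 [set u; w] R.
  by rewrite (card_triangle vu uw vw) !inE eqxx orbT => -[].
exists (symdiff D R); split.
- apply/subsetP => f; rewrite mem_symdiff; case: (boolP (f \in D)) => [/(subsetP DE)//|_].
  rewrite /= !inE => /orP[/orP[]|]/eqP->.
  + exact: sides_sub vui.
  + exact: sides_sub (triface_yz tf3).
  + exact: sides_sub vwi.
- exact: even_symdiff eD (triangle_even vu uw vw).
- have := card_symdiff D R; rewrite R2 (card_triangle vu uw vw).
  rewrite (_ : 2 * 2 = 1 + 3) // addnA => e.
  by rewrite -cD -(@addIn 3 _ _ e) /= addn1 addSn addnS.
move=> v' u' w' cv'; rewrite inE negb_or => /andP[v'v v's].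
have [vuD' vwD' uwD'] := memD _ _ _ cv' v's.
have chord' := corner_at_chord cv'.
have vv' : v != v' by rewrite eq_sym.
have [_ [_ [_ [_ [_ _ _ [_ vui' vwi']]]]]] := cv'.
have side f : f \in sides i -> f != [set u; w].
  by apply: contraTneq => ->.
rewrite !mem_symdiff vuD' vwD' (negbTE uwD') !in_setU !in_set1.
rewrite (negbTE (side _ vui')) (negbTE (side _ vwi')).
have cvs := corner_at_sym cv; have cvs' := corner_at_sym cv'.
have n c d c' d' : corner_at v c d i -> corner_at v' c' d' i ->
    ([set v'; c'] == [set v; c]) = false.
  by move=> h h'; apply/eqP => e; apply: (corner_disjoint_side h h' vv').
rewrite (n _ _ _ _ cv cv') (n _ _ _ _ cvs cv') (n _ _ _ _ cv cvs').
rewrite (n _ _ _ _ cvs cvs') /=.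
have nc f : f \in sides i -> ([set u'; w'] == f) = false.
  by move=> fi; apply: contraNF chord' => /eqP->.
rewrite (nc _ vui) (nc _ vwi) orbF; split=> //.
by apply/eqP => e; apply: (corner_disjoint_chord cv cv' vv').
Qed.

(** Otherwise cutting off nsides i - 5 corners would leave an even set of size 5. *)
Lemma short_corners_le i : #|[set v | `[< short_corner v i >]]| <= nsides i - 6.
Proof.
set M := [set v | _].
case: (posnP #|M|) => [->//|/card_gt0P[v0]]; rewrite inE => /asboolP[u0 [w0]].
case=> z [t [t' [t3 [_ _ _ [s6 _ _]]]]].
rewrite leqNgt; apply/negP => big.
have sM : size (take (nsides i - 5) (enum M)) = nsides i - 5.
  rewrite size_take -cardE; move: big; rewrite -subSn // subSS => big.
  by case: ltnP => // h; apply/eqP; rewrite eqn_leq h big.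
have [||D [DE eD cD _]] := @shortcuts i (take (nsides i - 5) (enum M)).
- by rewrite take_uniq // enum_uniq.
- by move=> v /mem_take; rewrite mem_enum inE => /asboolP.
have cD5 : #|D| = 5.
  by move: cD; rewrite sM => e; apply: (@addIn (nsides i - 5)); rewrite e subnKC // ltnW.
have [x [y [y' [a [b]]]]] := even_C5 (sub_simple DE sE) eD cD5.
case=> U e1 e2 e3 [e4 e5]; apply: (noC5 U); exact: (subsetP DE).
Qed.

Lemma sum_faces (h : I -> {set T} -> nat) :
  \sum_(i in F) \sum_(f in sides i) h i f = \sum_(f in E) (h (l f) f + h (r f) f).
Proof.
rewrite (exchange_big_dep (mem E)) /=; last by move=> i f _ /sides_sub.
apply: eq_bigr => f fE; rewrite (eq_bigl (mem [:: l f; r f])) => [|i].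
  by rewrite -big_uniq /= ?inE ?loopless // !big_cons big_nil addn0.
have e : (i \in [:: l f; r f]) = (f \in sides i) by rewrite sidesE // !inE !(eq_sym i).
rewrite -[RHS]/(i \in [:: l f; r f]) e; case: (boolP (f \in sides i)) => [fi|_].
  by rewrite (sides_face fi).
by rewrite andbF.
Qed.

(** The first term is what the edges give to their two ends through the side i, the
second one pays 36 for each short corner on i. *)
Lemma face_charge i : i \in F ->
  nsides i * (2 * side_weight (nsides i)) + 36 * (nsides i - 6) + 264 <= 92 * nsides i.
Proof.
move=> /nsides_cases; rewrite /side_weight; case=> [->//|->//|h].
by rewrite !gtn_eqF ?(leq_trans _ h) //; move: (nsides i) h => k h; lia.
Qed.

Definition edge_cost f : nat := if ntri f == 2 then 4 else 52.

(** Summing the charges over the triangles, as the shares do, counts an edge with one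
triangular face for 52 and an edge with two of them for 4 each time: in both cases
twice its weight. It matters here that the other face of an edge with a single
triangular face is long. *)
Lemma edge_charge f : f \in E ->
  ntri f * edge_cost f + (if ntri f == 0 then 2 * weight f else 0) = 2 * weight f.
Proof.
move=> fE; have fl : f \in sides (l f) by rewrite sidesE // eqxx.
have fr : f \in sides (r f) by rewrite sidesE // eqxx orbT.
have q4 i : f \in sides i -> nsides i = 4 -> ntri f = 0 by apply: quad_ntri0.
have q1 := q4 _ fl; have q2 := q4 _ fr; move: q1 q2; rewrite /edge_cost /weight /side_weight /ntri.
case: (nsides (l f) =P 3) => _; case: (nsides (r f) =P 3) => _ //=.
  by move=> _; case: (nsides (r f) =P 4) => // e /(_ e).
by case: (nsides (l f) =P 4) => // e /(_ e).
Qed.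

Theorem discharging_bound : 5 * #|E| + 33 <= 12 * #|V|.
Proof.
pose short v := [exists i, `[< short_corner v i >]].
have vx v : v \in V -> 72 <= triangle_income v + edge_income v + 36 * short v.
  move=> vV; case: (vertex_charge vV) => [h|[h [i si]]].
    exact: leq_trans h (leq_addr _ _).
  have -> : short v by apply/existsP; exists i; apply/asboolP.
  by rewrite muln1 addnAC; apply: leq_trans (leq_addr _ _); apply: (@leq_add 36 36).
have sumV : 72 * #|V| <= \sum_v triangle_income v + \sum_v edge_income v + 36 * \sum_v short v.
  rewrite mulnC -sum_nat_const big_distrr /= -!big_split /=.
  rewrite [X in _ <= X](bigID (mem V)) /=; apply: leq_trans (leq_addr _ _).
  exact: leq_sum.
have sumQ1 : \sum_v triangle_income v <= \sum_(f in E) ntri f * edge_cost f.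
  rewrite /triangle_income (exchange_big_dep (fun t => (t \in F) && (nsides t == 3))) /=; last first.
    move=> v t _ /andP[s3 /exists_inP[f ft _]]; by rewrite s3 (sides_face ft).
  have -> : \sum_(f in E) ntri f * edge_cost f =
      \sum_(t in F) \sum_(f in sides t) (nsides t == 3) * edge_cost f.
    by rewrite sum_faces; apply: eq_bigr => f _; rewrite -mulnDl.
  rewrite [X in _ <= X](bigID (fun t => nsides t == 3)) /=.
  apply: leq_trans (leq_addr _ _); apply: leq_sum => t /andP[tF /eqP s3].
  rewrite (eq_bigl (on_face^~ t)) => [|v]; last by rewrite /triangles_at s3.
  rewrite -(leq_add2r (48 * nshared t)); apply: leq_trans (share_sum s3) _.
  rewrite s3 /nshared -sum1_card big_distrr /= [X in _ + X](eq_bigl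
    (fun f => (f \in sides t) && (ntri f == 2))) => [|f]; last by rewrite inE.
  rewrite [X in _ + X]big_mkcondr /= -big_split /=.
  rewrite (eq_bigr (fun=> 52)) => [|f _]; first by rewrite sum_nat_const -/(nsides t) s3.
  by rewrite /edge_cost; case: eqP.
have sumQ2 : \sum_v edge_income v = \sum_(f in E) (if ntri f == 0 then 2 * weight f else 0).
  rewrite /edge_income (exchange_big_dep (fun f => (f \in E) && (ntri f == 0))) /=; last first.
    by move=> v f _; rewrite inE => /andP[/andP[-> _] ->].
  rewrite -big_mkcondr; apply: eq_bigr => f /andP[fE f0].
  rewrite (eq_bigl (mem f)) => [|v]; last by rewrite inE fE f0 andbT.
  by rewrite sum_nat_const sE.
have sumS : \sum_v short v <= \sum_(i in F) (nsides i - 6).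
  apply: (@leq_trans (\sum_v \sum_(i in F) `[< short_corner v i >])).
    apply: leq_sum => v _; case: (boolP (short v)) => // /existsP[i /asboolP si].
    have iF : i \in F by case: si => [u [w [z [? [? [? [_ _ _ [_ /sides_face]]]]]]]].
    by rewrite (bigD1 i) //= asboolT.
  rewrite exchange_big /=; apply: leq_sum => i _.
  apply: leq_trans (short_corners_le i); rewrite -sum1_card [X in _ <= X]big_mkcond /=.
  by apply: leq_sum => v _; rewrite inE; case: asboolP.
have sumE : \sum_(f in E) 2 * weight f = \sum_(i in F) nsides i * (2 * side_weight (nsides i)).
  have -> : \sum_(i in F) nsides i * (2 * side_weight (nsides i)) =
      \sum_(i in F) \sum_(f in sides i) 2 * side_weight (nsides i).
    by apply: eq_bigr => i _; rewrite sum_nat_const.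
  by rewrite sum_faces; apply: eq_bigr => f _; rewrite mulnDr.
have sumF : \sum_(i in F) nsides i = 2 * #|E|.
  have -> : \sum_(i in F) nsides i = \sum_(i in F) \sum_(f in sides i) 1.
    by apply: eq_bigr => i _; rewrite sum1_card.
  by rewrite sum_faces sum_nat_const mulnC.
have total : 72 * #|V| + 264 * #|F| <= 184 * #|E|.
  have -> : 184 * #|E| = \sum_(i in F) 92 * nsides i.
    by rewrite -big_distrr /= sumF mulnA.
  apply: (@leq_trans (\sum_(i in F) (nsides i * (2 * side_weight (nsides i)) + 36 * (nsides i - 6) + 264))).
    rewrite big_split /= [X in _ <= X + _]big_split /=.
    rewrite [X in _ <= _ + X]sum_nat_const (mulnC #|_| 264) leq_add2r.
    apply: leq_trans sumV _; rewrite sumQ2 -big_distrr /= leq_add //.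
      by rewrite -sumE -(eq_bigr _ edge_charge) big_split /= leq_add2r.
    by rewrite leq_mul2l.
  by apply: leq_sum => i; exact: face_charge.
have [v0 v0V] : exists v, v \in V by apply/card_gt0P; apply: leq_trans V5.
have [i0 i0F] : exists i, i \in F by apply/card_gt0P; apply: leq_trans many_faces.
case: dualE => lrF dE _.
have := euler_ineq sE EV lrF dE v0V i0F; move: total.
by move: #|V| #|E| #|F| => n e k; clear; lia.
Qed.

End Discharging.

(** * Induction on the number of vertices *)

Section Induction.
Variable T : finType.
Implicit Types (V : {set T}) (E : {set {set T}}).

Definition C5_free E : Prop := forall x y z a b, uniq [:: x; y; z; a; b] ->
  [set x; y] \in E -> [set y; z] \in E -> [set z; a] \in E ->
  [set a; b] \in E -> [set b; x] \in E -> False.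

Definition adj E : rel T := fun u w => [set u; w] \in E.

(** The paths whose lengths are called for join two vertices through d copies of K4,
each of which is crossed in 1, 2 or 3 steps. *)
Definition spread V E k : Prop :=
  forall a b, a \in V -> b \in V -> a != b ->
  exists2 d, 0 < d <= k & forall m, d <= m <= 3 * d ->
    exists p, [/\ path (adj E) a p, last a p = b, uniq (a :: p) & size p = m].

Definition C5_bound V E : Prop :=
  [\/ 5 * #|E| + 33 <= 12 * #|V|, #|E| + 3 <= 2 * #|V| |
   exists k, [/\ #|V| = 3 * k + 1, #|E| = 6 * k & spread V E k]].

Lemma path_in V E a p : (forall f, f \in E -> f \subset V) ->
  path (adj E) a p -> {subset p <= V}.
Proof.
move=> EV; elim: p a => [|c p IHp] a //= /andP[ac pp] u.
rewrite inE => /orP[/eqP->|]; last exact: (IHp c pp).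
by apply: (subsetP (EV _ ac)); rewrite !inE eqxx orbT.
Qed.

Lemma sub_adj_path E E' a p : E \subset E' -> path (adj E) a p -> path (adj E') a p.
Proof. by move=> /subsetP EE'; apply: sub_path => u w; exact: EE'. Qed.

Lemma spread_glue V1 V2 E1 E2 k1 k2 x : V1 :&: V2 = [set x] ->
    (forall f, f \in E1 -> f \subset V1) -> (forall f, f \in E2 -> f \subset V2) ->
    spread V1 E1 k1 -> spread V2 E2 k2 ->
  spread (V1 :|: V2) (E1 :|: E2) (k1 + k2).
Proof.
have cross V V' E E' k k' a b : V :&: V' = [set x] ->
    (forall f, f \in E -> f \subset V) -> (forall f, f \in E' -> f \subset V') ->
    spread V E k -> spread V' E' k' -> a \in V -> b \in V' -> a != x -> b != x ->
    exists2 d, 0 < d <= k + k' & forall m, d <= m <= 3 * d ->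
    exists p, [/\ path (adj (E :|: E')) a p, last a p = b, uniq (a :: p) & size p = m].
  move=> VV' EV EV' sp sp' aV bV' ax bx.
  have := set11 x; rewrite -VV' inE => /andP[xV xV'].
  have [d /andP[d0 dk] hd] := sp a x aV xV ax.
  have [|d' /andP[d0' dk'] hd'] := sp' x b xV' bV'; first by rewrite eq_sym.
  (* Crossing both parts takes any length between the sums of the bounds. *)
  exists (d + d'); first by apply/andP; split; [rewrite addn_gt0 d0 | exact: leq_add].
  move=> m hm.
  (* The first path is taken as long as possible. *)
  have [m1 [m2 [em h1 h2]]] : exists m1 m2, [/\ m = m1 + m2, d <= m1 <= 3 * d &
      d' <= m2 <= 3 * d'].
    exists (minn (3 * d) (m - d')), (m - minn (3 * d) (m - d')).
    by move: d0 d0' hm; clear; split; lia.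
  have [p [pp lp up sp1]] := hd _ h1; have [q [qp lq uq sq]] := hd' _ h2.
  exists (p ++ q); split.
  - rewrite cat_path lp (sub_adj_path _ pp) ?subsetUl //.
    by rewrite (sub_adj_path _ qp) ?subsetUr.
  - by rewrite last_cat lp.
  - rewrite -cat_cons cat_uniq up /=; move: uq => /= /andP[xq ->]; rewrite andbT.
    apply/hasPn => u uq; apply: contraNN xq => uap.
    suff -> : x = u by [].
    apply/esym/set1P; rewrite -VV' inE (path_in EV' qp uq) andbT.
    by move: uap; rewrite inE => /orP[/eqP->//|/(path_in EV pp)].
  - by rewrite size_cat sp1 sq em.
move=> VV EV1 EV2 sp1 sp2 a b; rewrite !inE => aV bV ab.
have VV' : V2 :&: V1 = [set x] by rewrite setIC.
have in1 V V' E E' k k' : spread V E k -> a \in V -> b \in V ->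
    exists2 d, 0 < d <= k + k' & forall m, d <= m <= 3 * d ->
    exists p, [/\ path (adj (E :|: E')) a p, last a p = b, uniq (a :: p) & size p = m].
  move=> sp aV' bV'; have [d /andP[d0 dk] hd] := sp a b aV' bV' ab.
  exists d; first by rewrite d0 (leq_trans dk) // leq_addr.
  move=> m /hd[p [pp lp up spm]]; exists p; split=> //.
  by apply: sub_adj_path pp; rewrite subsetUl.
case: (boolP ((a \in V1) && (b \in V1))) => [/andP[a1 b1]|n1]; first exact: in1 sp1 a1 b1.
case: (boolP ((a \in V2) && (b \in V2))) => [/andP[a2 b2]|n2].
  by rewrite addnC setUC; apply: in1 sp2 a2 b2.
have := set11 x; rewrite -VV inE => /andP[x1 x2].
have ax : a != x by apply/eqP => e; move: n1 n2 bV; rewrite e x1 x2 /=; do 2 case: (_ \in _).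
have bx : b != x by apply/eqP => e; move: n1 n2 aV; rewrite e x1 x2 !andbT; do 2 case: (_ \in _).
case/orP: aV => aV; case/orP: bV => bV.
- by rewrite aV bV in n1.
- exact: (cross _ _ _ _ _ _ a b VV).
- by rewrite addnC setUC; apply: (cross _ _ _ _ _ _ a b VV').
- by rewrite aV bV in n2.
Qed.

Lemma card_edges_le V E : simple_graph E -> (forall f, f \in E -> f \subset V) ->
  #|E| <= 'C(#|V|, 2).
Proof.
move=> sE EV; rewrite -cards_draws; apply: subset_leq_card.
by apply/subsetP => f fE; rewrite inE EV // sE.
Qed.

Lemma spread_K4 V E : simple_graph E -> (forall f, f \in E -> f \subset V) ->
  #|V| = 4 -> #|E| = 6 -> spread V E 1.
Proof.
move=> sE EV V4 E6 a b aV bV ab.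
have full u w : u \in V -> w \in V -> u != w -> [set u; w] \in E.
  move=> uV wV uw; suff -> : E = [set f : {set T} | f \subset V & #|f| == 2].
    by rewrite inE subUset !sub1set uV wV cards2 uw.
  apply/eqP; rewrite eqEcard cards_draws V4 E6 andbT.
  by apply/subsetP => f fE; rewrite inE EV // sE.
have [c [d [cV dV U]]] : exists c d, [/\ c \in V, d \in V & uniq [:: a; c; d; b]].
  have /eqP/cards2P[c [d [cd eV]]] : #|V :\ a :\ b| = 2.
    have := cardsD1 a V; rewrite V4 aV (cardsD1 b (V :\ a)) !inE bV eq_sym ab /=.
    by move=> [/esym].
  have := set21 c d; have := set22 c d; rewrite -eV !inE.
  move=> /and3P[db da dV] /and3P[cb ca cV]; exists c, d; split=> //.
  by rewrite /= !inE !negb_or (eq_sym a) ca (eq_sym a) da ab cd cb db.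
exists 1 => // m; move: U; rewrite /= !inE !negb_or -!andbA andbT.
move=> /and5P[ac ad _ cd /andP[cb db]].
case: m => [|[|[|[|m]]]] // _.
- by exists [:: b]; rewrite /= /adj full // inE ab.
- by exists [:: c; b]; rewrite /= /adj !full // !inE negb_or ac ab cb.
- by exists [:: c; d; b]; rewrite /= /adj !full // !inE !negb_or ac ad ab cd cb db.
Qed.

Lemma C5_bound_cut V1 V2 E1 E2 x : V1 :&: V2 = [set x] -> [disjoint E1 & E2] ->
    (forall f, f \in E1 -> f \subset V1) -> (forall f, f \in E2 -> f \subset V2) ->
  C5_bound V1 E1 -> C5_bound V2 E2 -> C5_bound (V1 :|: V2) (E1 :|: E2).
Proof.
move=> VV EE EV1 EV2.
have eV : #|V1 :|: V2| + 1 = #|V1| + #|V2| by rewrite -(cards1 x) -VV cardsUI.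
have eE : #|E1 :|: E2| = #|E1| + #|E2|.
  by rewrite cardsU (eqP (_ : #|_ :&: _| == 0)) ?subn0 // cards_eq0 setI_eq0.
have V10 : 0 < #|V1|.
  by have := set11 x; rewrite -VV inE => /andP[xV _]; apply/card_gt0P; exists x.
have V20 : 0 < #|V2|.
  by have := set11 x; rewrite -VV inE => /andP[_ xV]; apply/card_gt0P; exists x.
rewrite /C5_bound eE.
case=> [h1|h1|[k1 [n1 e1 sp1]]]; case=> [h2|h2|[k2 [n2 e2 sp2]]].
- constructor 1; move: eV V10 V20 h1 h2.
  by move: #|V1 :|: V2| #|V1| #|V2| #|E1| #|E2| => *; lia.
- constructor 1; move: eV V10 V20 h1 h2.
  by move: #|V1 :|: V2| #|V1| #|V2| #|E1| #|E2| => *; lia.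
- constructor 1; move: eV V10 V20 h1 n2 e2.
  by move: #|V1 :|: V2| #|V1| #|V2| #|E1| #|E2| => *; lia.
- constructor 1; move: eV V10 V20 h1 h2.
  by move: #|V1 :|: V2| #|V1| #|V2| #|E1| #|E2| => *; lia.
- constructor 2; move: eV V10 V20 h1 h2.
  by move: #|V1 :|: V2| #|V1| #|V2| #|E1| #|E2| => *; lia.
- constructor 2; move: eV V10 V20 h1 n2 e2.
  by move: #|V1 :|: V2| #|V1| #|V2| #|E1| #|E2| => *; lia.
- constructor 1; move: eV V10 V20 h2 n1 e1.
  by move: #|V1 :|: V2| #|V1| #|V2| #|E1| #|E2| => *; lia.
- constructor 2; move: eV V10 V20 h2 n1 e1.
  by move: #|V1 :|: V2| #|V1| #|V2| #|E1| #|E2| => *; lia.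
constructor 3; exists (k1 + k2); split; last exact: spread_glue VV EV1 EV2 sp1 sp2.
  move: eV n1 n2; move: #|V1 :|: V2| #|V1| #|V2| => *; lia.
by rewrite e1 e2 mulnDr.
Qed.

Lemma C5_bound_small V E : simple_graph E -> (forall f, f \in E -> f \subset V) ->
  0 < #|V| -> #|V| < 5 -> C5_bound V E.
Proof.
move=> sE EV V0 V5; have := card_edges_le sE EV; rewrite /C5_bound.
move eV : #|V| V0 V5 => n; case: n eV => [|[|[|[|[|n]]]]] eV // _ _.
- rewrite leqn0 => /eqP e0; constructor 3; exists 0; split=> // a b aV bV.
  have /eqP/cards1P[c ec] := eV; move: aV bV; rewrite ec !inE => /eqP-> /eqP->.
  by rewrite eqxx.
- by move=> h; constructor 2; exact: (@leq_add _ _ 1 3).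
- by move=> h; constructor 2; exact: (@leq_add _ _ 3 3).
- rewrite leq_eqVlt => /orP[/eqP e6|h]; last by constructor 2; exact: (@leq_add _ _ 5 3).
  by constructor 3; exists 1; split=> //; exact: spread_K4.
Qed.

(** The critical case is a vertex of degree 2 added to a tree of at most three copies
of K4: its neighbours are joined by a path of length 3, which closes a pentagon. *)
Lemma C5_bound_vertex V E v : simple_graph E -> (forall f, f \in E -> f \subset V) ->
    C5_free E -> v \in V -> 4 < #|V| -> deg E v <= 2 ->
  C5_bound (V :\ v) (E :\: star E v) -> C5_bound V E.
Proof.
move=> sE EV c5 vV V5 d2.
have eE : #|E| = deg E v + #|E :\: star E v|.
  rewrite -(cardsID (star E v) E) (setIidPr _) //.
  by apply/subsetP => f; rewrite inE => /andP[].
have eV : #|V| = 1 + #|V :\ v| by rewrite (cardsD1 v) vV.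
rewrite /C5_bound; case=> [h|h|[k [n1 e1 sp]]].
- constructor 1; move: eE eV d2 h.
  by move: #|V| #|V :\ v| #|E| #|_ :\: _| (deg _ _) => *; lia.
- constructor 2; move: eE eV d2 h.
  by move: #|V| #|V :\ v| #|E| #|_ :\: _| (deg _ _) => *; lia.
case: (ltnP (deg E v) 2) => d1.
  constructor 2; move: eE eV d1 n1 e1.
  by move: #|V| #|V :\ v| #|E| #|_ :\: _| (deg _ _) => *; lia.
case: (ltnP 3 k) => k3.
  constructor 1; move: eE eV d2 n1 e1 k3.
  by move: #|V| #|V :\ v| #|E| #|_ :\: _| (deg _ _) => *; lia.
have /eqP/cards2P[f [g [fg eS]]] : deg E v = 2 by apply/eqP; rewrite eqn_leq d2.
have := set21 f g; have := set22 f g; rewrite -eS !inE => /andP[gE vg] /andP[fE vf].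
have [a av ef] := edgeP sE fE vf; have [b bv eg] := edgeP sE gE vg; subst f g.
have ab : a != b by apply: contraNneq fg => ->.
have inV c : [set v; c] \in E -> c != v -> c \in V :\ v.
  by move=> /EV/subsetP vc cv; rewrite !inE cv vc // !inE eqxx orbT.
have [d /andP[d0 dk] hd] := sp a b (inV _ fE av) (inV _ gE bv) ab.
have d3 : d <= 3 <= 3 * d by move: d0 dk k3; clear; lia.
have [[|x [|y [|z [|? ?]]]] [pp lp up //]] := hd _ d3.
have EV' f : f \in E :\: star E v -> f \subset V :\ v.
  rewrite !inE negb_and => /andP[+ fE']; rewrite fE' /= => vf'.
  by rewrite subsetD1 EV.
have pV := path_in EV' pp; move: lp pp => /= zb /and4P[ax xy yz _]; subst z.
have sub u w : adj (E :\: star E v) u w -> [set u; w] \in E.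
  by rewrite /adj inE => /andP[].
case: (c5 v a x y b) => //.
- have nv u : u \in [:: x; y; b] -> v != u.
    by move/pV; rewrite !inE eq_sym => /andP[].
  have [vx [vy vb]] : v != x /\ v != y /\ v != b.
    by split; [|split]; apply: nv; rewrite !inE eqxx ?orbT.
  by move: up; rewrite /= !inE !negb_or (eq_sym v a) av vx vy vb.
- exact: sub ax.
- exact: sub xy.
- exact: sub yz.
- by rewrite setUC.
Qed.

Definition hereditary_dual E : Prop :=
  forall E', E' \subset E -> has_dual E'.

(** A graph with at least five vertices either has a vertex of degree at most 2, or is
the union of two smaller graphs with one common vertex (this includes disconnected
graphs), or is two-connected with minimum degree 3 and the discharging applies. *)
Theorem planar_C5_bound V E : simple_graph E -> (forall f, f \in E -> f \subset V) ->
  C5_free E -> hereditary_dual E -> 0 < #|V| -> C5_bound V E.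
Proof.
have [n] := ubnP #|V|; elim: n => // n IHn in V E * => ltV sE EV c5 hE V0.
case: (ltnP #|V| 5) => V5; first exact: C5_bound_small.
have IH V' E' : #|V'| < #|V| -> E' \subset E -> (forall f, f \in E' -> f \subset V') ->
    0 < #|V'| -> C5_bound V' E'.
  move=> lt EE EV' V'0; apply: IHn => //.
  - exact: leq_trans lt _.
  - exact: sub_simple EE sE.
  - move=> x y z a b U e1 e2 e3 e4 e5.
    by apply: (c5 _ _ _ _ _ U); exact: (subsetP EE).
  - by move=> E'' sub; apply: hE; exact: subset_trans EE.
case: (boolP [exists v in V, deg E v <= 2]) => [/exists_inP[v vV d2]|].
  have eV : #|V| = 1 + #|V :\ v| by rewrite (cardsD1 v) vV.
  apply: (C5_bound_vertex sE EV c5 vV V5 d2); apply: IH.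
  - by rewrite eV.
  - exact: subsetDl.
  - move=> f; rewrite !inE negb_and => /andP[+ fE']; rewrite fE' /= => vf'.
    by rewrite subsetD1 EV.
  - by move: V5; rewrite eV; case: #|_|.
rewrite negb_exists => /forallP md.
have mindeg v : v \in V -> 2 < deg E v by move=> vV; have := md v; rewrite vV ltnNge.
have [conn|] := boolP [forall x in V, forall a in V, forall b in V,
    (a != x) ==> (b != x) ==> connect (avoid E x) a b].
  have conn' : two_connected V E.
    move=> x a b xV aV bV ax bx; move/forall_inP/(_ x xV)/forall_inP/(_ a aV): conn.
    by move/forall_inP/(_ b bV); rewrite ax bx.
  have [I [l [r dlr]]] := hE E (subxx _).
  have [|F [l' [r' cF]]] := @connected_faces_exist _ _ E l r setT _ dlr.
    by move=> f _; rewrite !inE.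
  by constructor 1; exact: discharging_bound sE EV conn' cF c5 mindeg V5.
move=> /forall_inPn[x xV /forall_inPn[a aV /forall_inPn[b bV]]].
rewrite !negb_imply => /and3P[ax bx nab].
pose A := [set u in V | connect (avoid E x) a u].
have xA : x \notin A.
  rewrite inE negb_and; apply/orP; right; apply/negP => /connectP[p].
  elim/last_ind: p => [|p u _]; first by move=> _ /= e; rewrite e eqxx in ax.
  by rewrite rcons_path last_rcons => /andP[_ /and3P[_ _ ux]] e; rewrite e eqxx in ux.
have aA : a \in A by rewrite inE aV connect0.
have bA : b \notin A by rewrite inE bV.
have AV : A \subset V by apply/subsetP => u; rewrite inE => /andP[].
pose V1 := x |: A; pose V2 := V :\: A.
pose E1 := [set f in E | f \subset V1]; pose E2 := [set f in E | f \subset V2].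
have eV : V1 :|: V2 = V.
  apply/setP => u; rewrite !inE; case: (eqVneq u x) => [->|_]; rewrite ?xV //=.
  by case: (boolP (u \in V)) => //=; rewrite ?andbF ?andbT; case: connect.
have VV : V1 :&: V2 = [set x].
  apply/setP => u; rewrite !in_setI in_setD in_setU1 in_set1.
  case: (eqVneq u x) => [->|_] /=; first by rewrite xA xV.
  by case: (u \in A).
have EE : [disjoint E1 & E2].
  rewrite disjoint_subset; apply/subsetP => f; rewrite !inE => /andP[fE f1].
  rewrite fE /=; apply/negP => f2.
  have : f \subset [set x] by rewrite -VV subsetI f1.
  by move/subset_leq_card; rewrite sE // cards1.
have eE : E1 :|: E2 = E.
  apply/setP => f; rewrite !inE -andb_orr; case: (boolP (f \in E)) => //= fE.
  have fV := EV _ fE.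
  case: (boolP (f \subset V2)) => [_|]; rewrite ?orbT // orbF.
  move=> /subsetPn[u uf]; rewrite inE (subsetP fV _ uf) andbT negbK => uA.
  have [w wu ef] := edgeP sE fE uf; subst f.
  rewrite subUset !sub1set !in_setU1 uA orbT /=.
  case: (eqVneq w x) => //= wx; rewrite inE (subsetP fV) ?inE ?eqxx ?orbT //=.
  have ux : u != x by apply: contraNneq xA => <-.
  move: uA; rewrite inE => /andP[_ au]; apply: connect_trans au _.
  by apply: connect1; rewrite /avoid fE ux.
rewrite -eV -eE; apply: (C5_bound_cut VV EE).
- by move=> f; rewrite inE => /andP[].
- by move=> f; rewrite inE => /andP[].
- apply: IH.
  + apply: proper_card; rewrite properE subUset sub1set xV AV /=.
    by apply/subsetPn; exists b; rewrite // in_setU1 negb_or bx.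
  + by apply/subsetP => f; rewrite inE => /andP[].
  + by move=> f; rewrite inE => /andP[].
  + by apply/card_gt0P; exists x; rewrite in_setU1 eqxx.
apply: IH.
+ apply: proper_card; rewrite properE subsetDl /=.
  by apply/subsetPn; exists a; rewrite // in_setD aA.
+ by apply/subsetP => f; rewrite inE => /andP[].
+ by move=> f; rewrite inE => /andP[].
+ by apply/card_gt0P; exists x; rewrite in_setD xA.
Qed.

Lemma C5_bound_large V E : 10 < #|V| -> C5_bound V E -> 5 * #|E| + 33 <= 12 * #|V|.
Proof.
move=> + [//|h|[k [nk ek _]]]; [move: h | move: nk ek];
  by move: #|V| #|E| => *; lia.
Qed.

End Induction.

(** * Duals of minors *)

Section Minors.
Variables (T G I0 : finType) (P : choiceType) (p0 : P).
Variables (s t : G -> P) (l0 r0 : G -> I0).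
Implicit Types (g : G) (p q z : P) (x y : T) (c : G -> bool) (a : I0 -> bool).

(** Sets of edges of the big graph are handled as chains over the field with two
elements, that is, boolean functions on the edges. *)
Definition chain_bd c p : bool :=
  \big[addb/false]_g (c g && ((s g == p) (+) (t g == p))).

Lemma chain_bdD c d p : chain_bd (fun g => c g (+) d g) p = chain_bd c p (+) chain_bd d p.
Proof.
by rewrite /chain_bd -big_split; apply: eq_bigr => g _ /=; case: (c g); case: (d g);
  case: (s g == p); case: (t g == p).
Qed.

Lemma chain_bd_sum (J : finType) (C : pred J) (c : J -> G -> bool) p :
  chain_bd (fun g => \big[addb/false]_(j | C j) c j g) p =
  \big[addb/false]_(j | C j) chain_bd (c j) p.
Proof.
rewrite /chain_bd exchange_big /=; apply: eq_bigr => g _.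
by rewrite big_distrl.
Qed.

Lemma chain_bd1 g p : chain_bd (fun h => h == g) p = (s g == p) (+) (t g == p).
Proof.
rewrite /chain_bd (bigD1 g) //= eqxx big1 ?addbF // => h /negbTE->.
by [].
Qed.

Lemma chain_bd0 p : chain_bd (fun=> false) p = false.
Proof. by rewrite /chain_bd big1. Qed.

(** The cut of a set of faces, as a chain. *)
Definition coboundary a : G -> bool := fun g => a (l0 g) (+) a (r0 g).

Variables (beta : P -> option T) (eps : {set T} -> G) (E : {set {set T}}).
Hypothesis exact_dual : forall c, (forall p, chain_bd c p = false) ->
  exists a, forall g, c g = coboundary a g.
Hypothesis cut_closed : forall a p, beta p -> chain_bd (coboundary a) p = false.
Hypothesis fibre_connected : forall x p q, beta p = Some x -> beta q = Some x ->
  exists c, (forall g, c g -> beta (s g) = Some x /\ beta (t g) = Some x) /\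
    forall z, chain_bd c z = (p == z) (+) (q == z).
Hypothesis eps_edge : forall f, f \in E -> exists x y,
  [/\ f = [set x; y], x != y, beta (s (eps f)) = Some x & beta (t (eps f)) = Some y].

Let inner g : bool := isSome (beta (s g)) && (beta (s g) == beta (t g)).
Let keep g : bool := inner g || [exists f in E, eps f == g].
Let merged : rel I0 := fun i j => [exists g, ~~ keep g &&
  ((l0 g == i) && (r0 g == j) || (l0 g == j) && (r0 g == i))].

Let merged_sym : connect_sym merged.
Proof.
apply: sym_connect_sym => i j; apply: eq_existsb => g.
by rewrite orbC.
Qed.

Let eps_inj : {in E &, injective eps}.
Proof.
move=> f f' fE fE' e; have [x [y [ef _ sx ty]]] := eps_edge fE.
have [x' [y' [ef' _ sx' ty']]] := eps_edge fE'.
by move: sx ty; rewrite e sx' ty' ef ef' => -[->] [->].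
Qed.

Let eps_outer f : f \in E -> inner (eps f) = false.
Proof.
move=> fE; have [x [y [_ xy sx ty]]] := eps_edge fE.
by rewrite /inner sx ty /=; apply: contraNF xy => /eqP[->].
Qed.

Let eps_mem f x : f \in E ->
  (beta (s (eps f)) == Some x) (+) (beta (t (eps f)) == Some x) = (x \in f).
Proof.
move=> fE; have [u [w [ef uw -> ->]]] := eps_edge fE.
rewrite ef !inE !(inj_eq Some_inj) !(eq_sym x).
by case: (eqVneq u x) => [<-|_] //; rewrite eq_sym (negbTE uw).
Qed.

Let odd_deg (C : {set {set T}}) x :
  odd (deg C x) = \big[addb/false]_(f in C) (x \in f).
Proof.
rewrite /deg -sum1_card (big_morph odd oddD (erefl _)) big_mkcond [RHS]big_mkcond.
by apply: eq_bigr => f _; rewrite inE; case: (f \in C); case: (x \in f).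
Qed.

Let fibre_sum c x : (forall p, beta p -> chain_bd c p = false) ->
  \big[addb/false]_g (c g && ((beta (s g) == Some x) (+) (beta (t g) == Some x))) = false.
Proof.
move=> bc; pose pts := undup (codom s ++ codom t).
have upts : uniq pts by exact: undup_uniq.
have : \big[addb/false]_(p <- pts | beta p == Some x) chain_bd c p = false.
  by rewrite big1 // => p /eqP bp; rewrite bc // bp.
rewrite /chain_bd exchange_big /= => e; rewrite -[RHS]e; apply: eq_bigr => g _.
rewrite -big_distrr /= big_split /=; congr (_ && (_ (+) _)).
  rewrite big_mkcond (bigD1_seq (s g)) //=; last first.
    by rewrite mem_undup mem_cat codom_f.
  rewrite eqxx big1 => [|p /negbTE np]; last by rewrite (eq_sym (s g)) np if_same.
  by rewrite addbF; case: eqP.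
rewrite big_mkcond (bigD1_seq (t g)) //=; last first.
  by rewrite mem_undup mem_cat codom_f orbT.
rewrite eqxx big1 => [|p /negbTE np]; last by rewrite (eq_sym (t g)) np if_same.
by rewrite addbF; case: eqP.
Qed.

Let face (i : G -> I0) f := root merged (i (eps f)).

Let cut_even A : even_set (cut E (face l0) (face r0) A).
Proof.
pose a i := root merged i \in A.
apply/even_setP => x; rewrite odd_deg.
have a_out g : ~~ keep g -> coboundary a g = false.
  move=> ng; rewrite /coboundary /a; suff -> : root merged (l0 g) = root merged (r0 g).
    exact: addbb.
  apply/eqP; rewrite (root_connect merged_sym); apply: connect1.
  by apply/existsP; exists g; rewrite ng !eqxx.
rewrite -[RHS](@fibre_sum (coboundary a) x (cut_closed a)).
rewrite (bigID (mem (eps @: E))) /= [X in _ (+) X]big1 ?addbF => [|g gE]; last first.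
  case: (boolP (keep g)) => [|/a_out -> //]; rewrite /keep => /orP[].
    by rewrite /inner => /andP[_ /eqP->]; rewrite addbb andbF.
  by move=> /exists_inP[f fE /eqP eg]; rewrite -eg imset_f in gE.
rewrite big_imset //= big_mkcond [RHS]big_mkcond /=; apply: eq_bigr => f _.
rewrite inE; case: (boolP (f \in E)) => //= fE.
rewrite eps_mem // /coboundary /a -/(face l0 f) -/(face r0 f).
by case: (_ \in A); case: (_ \in A); case: (x \in f).
Qed.

(** The fibres of beta are contracted to the vertices of T and eps f is the edge of
the big graph kept for f; all the other edges outside the fibres are deleted. The
dual is obtained by merging the two faces of every deleted edge. A cut is even
because its boundary sums to 0 over each fibre. Conversely, an even set C lifts to
a cycle of the big graph: the ends of the edges eps f, for f in C, are joined
inside each fibre to a base point, where they cancel out. *)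
Theorem minor_has_dual : has_dual E.
Proof.
exists I0, (face l0), (face r0) => C CE; split; last by move=> [A ->].
move=> /even_setP eC.
have [base hbase] : {base : T -> P & forall x p, beta p = Some x ->
    beta (base x) = Some x}.
  apply: (@choice _ _ (fun x q => forall p, beta p = Some x -> beta q = Some x)) => x.
  have [[q bq]|none] := pselect (exists q, beta q = Some x).
    by exists q => p _.
  by exists p0 => p bp; case: none; exists p.
pose links p c := forall x, beta p = Some x ->
    (forall g, c g -> beta (s g) = Some x /\ beta (t g) = Some x) /\
    forall z, chain_bd c z = (p == z) (+) (base x == z).
have [pth hpth] : {pth : P -> G -> bool & forall p, links p (pth p)}.
  apply: (@choice _ _ links) => p; rewrite /links; case bp: (beta p) => [x|]; last by exists (fun=> false).
  have [c hc] := fibre_connected bp (hbase _ _ bp).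
  by exists c => _ [<-].
pose cf f g := (g == eps f) (+) (pth (s (eps f)) g (+) pth (t (eps f)) g).
pose c g := \big[addb/false]_(f in C) cf f g.
have inC f : f \in C -> f \in E by exact: (subsetP CE).
have pth_inner f p g : f \in E -> p = s (eps f) \/ p = t (eps f) -> pth p g -> inner g.
  move=> fE; have [x [y [_ _ sx ty]]] := eps_edge fE.
  by case=> ->; [have [h _] := hpth _ _ sx | have [h _] := hpth _ _ ty];
    move=> /h[e1 e2]; rewrite /inner e1 e2 /= eqxx.
have c_inner g : inner g = false -> c g = \big[addb/false]_(f in C) (g == eps f).
  move=> ng; apply: eq_bigr => f /inC fE; rewrite /cf.
  have -> : pth (s (eps f)) g = false.
    by apply: contraFF ng => h; exact: (pth_inner f _ g fE (or_introl erefl) h).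
  have -> : pth (t (eps f)) g = false.
    by apply: contraFF ng => h; exact: (pth_inner f _ g fE (or_intror erefl) h).
  by rewrite /= addbF.
have [a ha] : exists a, forall g, c g = coboundary a g.
  apply: exact_dual => z; rewrite chain_bd_sum.
  have bcf f : f \in C -> chain_bd (cf f) z =
      if beta z is Some w then (w \in f) && (base w == z) else false.
    move=> /inC fE; have [x [y [ef xy sx ty]]] := eps_edge fE.
    have [_ hx] := hpth _ _ sx; have [_ hy] := hpth _ _ ty.
    rewrite /cf chain_bdD chain_bd1 chain_bdD hx hy.
    have -> : (s (eps f) == z) (+) (t (eps f) == z) (+) ((s (eps f) == z) (+)
        (base x == z) (+) ((t (eps f) == z) (+) (base y == z))) =
        (base x == z) (+) (base y == z) by do 4 case: (_ == z).
    have bx := hbase _ _ sx; have by_ := hbase _ _ ty.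
    case bz: (beta z) => [w|].
      rewrite ef !inE; case: (eqVneq w x) => [ewx|wx].
        subst w; rewrite /=; case: (eqVneq (base y) z) => [e|_]; last by rewrite addbF.
        by move: by_; rewrite e bz => -[e']; rewrite e' eqxx in xy.
      case: (eqVneq w y) => [ewy|wy] /=.
        subst w; case: (eqVneq (base x) z) => // e.
        by move: bx; rewrite e bz => -[e']; rewrite e' eqxx in wx.
      case: (eqVneq (base x) z) => [e|_].
        by move: bx; rewrite e bz => -[e']; rewrite e' eqxx in wx.
      case: (eqVneq (base y) z) => [e|//].
      by move: by_; rewrite e bz => -[e']; rewrite e' eqxx in wy.
    case: (eqVneq (base x) z) => [e|_]; first by rewrite -e bx in bz.
    by case: (eqVneq (base y) z) => [e|//]; rewrite -e by_ in bz.
  rewrite (eq_bigr _ bcf); case: (beta z) => [w|]; last by rewrite big1.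
  by rewrite -big_distrl /= -odd_deg eC.
have a_root i : a (root merged i) = a i.
  have cl : closed merged a.
    move=> i' j /existsP[g /andP[ng gij]].
    have cg : coboundary a g = false.
      move: (ng); rewrite /keep negb_or => /andP[/negbTE ni nE].
      rewrite -ha c_inner // big1 // => f /inC fE; apply: contraNF nE => /eqP ->.
      by apply/existsP; exists f; rewrite fE eqxx.
    move: cg; rewrite /coboundary !unfold_in.
    by case/orP: gij => /andP[/eqP-> /eqP->]; case: (a _); case: (a _).
  have := closed_connect cl (connect_root merged i); rewrite !unfold_in.
  by move->.
exists [set i | a i]; apply/setP => f; rewrite inE.
case: (boolP (f \in E)) => fE /=; last by apply: contraNF fE => /inC.
rewrite !inE !a_root.
have -> : (a (l0 (eps f)) != a (r0 (eps f))) = c (eps f).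
  by rewrite ha /coboundary; case: (a _); case: (a _).
rewrite c_inner ?eps_outer //.
case: (boolP (f \in C)) => fC.
  rewrite (bigD1 f) //= eqxx big1 // => f' /andP[/inC fE' ff'].
  by apply: contraNF ff' => /eqP/eps_inj ->.
rewrite big1 // => f' fC'; apply: contraNF fC => /eqP/eps_inj -> //.
exact: inC.
Qed.

End Minors.

(** * Duals of graphs drawn on a grid *)

Section Grid.
Variable m : nat.
Let M := m.+1.

Definition grid_edge : finType := (bool * ('I_M * 'I_M))%type.
Definition grid_face : finType := ('I_M.+1 * 'I_M.+1)%type.
Implicit Types (g : grid_edge) (c : grid_edge -> bool) (a : grid_face -> bool).

Definition gsrc g : nat * nat := (val g.2.1, val g.2.2).

Definition gtgt g : nat * nat :=
  if g.1 then (val g.2.1, (val g.2.2).+1) else ((val g.2.1).+1, val g.2.2).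

(** Coordinates are shifted by one, so that the faces of index 0 are those on the left
of and below the grid. *)
Definition gface (i j : nat) : grid_face := (inord i, inord j).

Definition gleft g : grid_face :=
  if g.1 then gface g.2.1 g.2.2.+1 else gface g.2.1.+1 g.2.2.

Definition gright g : grid_face := gface g.2.1.+1 g.2.2.+1.

Definition chain_at c (b : bool) (i j : nat) : bool :=
  [exists g : grid_edge, (g.1 == b) && (gsrc g == (i, j)) && c g].

Lemma chain_at_edge c g : chain_at c g.1 g.2.1 g.2.2 = c g.
Proof.
apply/existsP/idP => [[h /andP[/andP[/eqP e1 /eqP[e2 e3]] ch]]|cg]; last first.
  by exists g; rewrite !eqxx.
move: h g e1 e2 e3 ch => [b [i j]] [b' [i' j']] /= -> e2 e3.
by rewrite (ord_inj e2) (ord_inj e3).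
Qed.

Lemma chain_at_out c b i j : ~~ ((i < M) && (j < M)) -> chain_at c b i j = false.
Proof.
move=> h; apply: contraNF h => /existsP[g /andP[/andP[_ /eqP[<- <-]] _]].
by rewrite !ltn_ord.
Qed.

Lemma chain_at_in c b i j (iM : i < M) (jM : j < M) :
  chain_at c b i j = c (b, (Ordinal iM, Ordinal jM)).
Proof. by rewrite -chain_at_edge. Qed.

Lemma sum_src c b (i j : nat) :
  \big[addb/false]_(g : grid_edge | g.1 == b) (c g && (gsrc g == (i, j))) = chain_at c b i j.
Proof.
case: (boolP ((i < M) && (j < M))) => [/andP[iM jM]|out]; last first.
  rewrite chain_at_out // big1 // => g _; apply: contraNF out.
  by move=> /andP[_ /eqP[<- <-]]; rewrite !ltn_ord.
rewrite (chain_at_in c b iM jM) (bigD1 (b, (Ordinal iM, Ordinal jM))) //= big1.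
  by rewrite /gsrc /= eqxx andbT addbF.
move=> [b' [i' j']] /= /andP[/eqP -> ne]; apply: contraNF ne.
move=> /andP[_ /eqP[e1 e2]]; apply/eqP; congr (_, (_, _)); exact: ord_inj.
Qed.

Lemma chain_bd_grid c i j : chain_bd gsrc gtgt c (i, j) =
  chain_at c false i j (+) ((0 < i) && chain_at c false i.-1 j) (+)
  (chain_at c true i j (+) ((0 < j) && chain_at c true i j.-1)).
Proof.
have -> : chain_bd gsrc gtgt c (i, j) =
    \big[addb/false]_(b : bool) \big[addb/false]_(g : grid_edge | g.1 == b)
      ((c g && (gsrc g == (i, j))) (+) (c g && (gtgt g == (i, j)))).
  rewrite /chain_bd (partition_big (fun g : grid_edge => g.1) predT) //=.
  apply: eq_bigr => b _; apply: eq_bigr => g _.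
  by case: (c g).
rewrite big_bool /= addbC; congr (_ (+) _); rewrite big_split /= sum_src; congr addb.
  case: i => [|i] /=.
    rewrite big1 // => -[b [i' j']] /= /eqP->; by rewrite /gtgt /= andbF.
  rewrite -sum_src; apply: eq_bigr => -[b [i' j']] /= /eqP->.
  by rewrite /gtgt /gsrc /= !xpair_eqE eqSS.
case: j => [|j] /=.
  rewrite big1 // => -[b [i' j']] /= /eqP->.
  by rewrite /gtgt /= xpair_eqE !andbF.
rewrite -sum_src; apply: eq_bigr => -[b [i' j']] /= /eqP->.
by rewrite /gtgt /gsrc /= !xpair_eqE eqSS.
Qed.

(** The colour of a face is the parity of the number of vertical edges on its left.
It changes across a vertical edge of c by definition, and across a horizontal one
because the boundary of c vanishes at all the points on its left. *)
Lemma grid_exact c : (forall p, chain_bd gsrc gtgt c p = false) ->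
  exists a, forall g, c g = coboundary gleft gright a g.
Proof.
(* col k y is the vertical edge between the faces (k, y) and (k.+1, y). *)
move=> bc; pose col k y := (0 < y) && chain_at c true k y.-1.
exists (fun x : grid_face => \big[addb/false]_(k < x.1) col k x.2).
move=> [b [i j]]; rewrite /coboundary /gleft /gright /=.
have iM := ltn_ord i; have jM := ltn_ord j.
case: b => /=.
  rewrite !inordK ?ltnS ?(ltnW iM) // big_ord_recr /= addbA addbb.
  by rewrite /col /= (chain_at_in c true iM jM); congr (c (_, (_, _))); exact: ord_inj.
rewrite !inordK ?ltnS ?(ltnW jM) //.
have -> : c (false, (i, j)) = chain_at c false i j.
  by rewrite (chain_at_in c false iM jM); congr (c (_, (_, _))); exact: ord_inj.
elim: (nat_of_ord i) => [|k IHk].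
  rewrite !big_ord_recr !big_ord0 /col /=; have := bc (0, nat_of_ord j).
  rewrite chain_bd_grid /= addbF; case: (chain_at c false 0 j); case: (chain_at c true 0 j);
  by case: (_ && _).
rewrite big_ord_recr [X in _ (+) X]big_ord_recr /=.
have := bc (k.+1, nat_of_ord j); rewrite chain_bd_grid /= {}IHk /col /=.
case: (chain_at c false k.+1 j); case: (chain_at c true k.+1 j);
  case: ((0 < j) && _); case: (\big[_/_]_(_ < _) _);
  by case: (\big[_/_]_(_ < _) _).
Qed.

Definition inner_point (z : nat * nat) : bool := (0 < z.1 < M) && (0 < z.2 < M).

Lemma grid_cut_closed a p : inner_point p ->
  chain_bd gsrc gtgt (coboundary gleft gright a) p = false.
Proof.
case: p => i j /andP[/= /andP[i0 iM] /andP[j0 jM]].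
rewrite chain_bd_grid i0 j0 /=.
have iM' : i.-1 < M by apply: leq_ltn_trans iM; exact: leq_pred.
have jM' : j.-1 < M by apply: leq_ltn_trans jM; exact: leq_pred.
rewrite (chain_at_in _ false iM jM) (chain_at_in _ true iM jM) (chain_at_in _ _ iM' jM) (chain_at_in _ _ iM jM').
rewrite /coboundary /gleft /gright /= (ltn_predK i0) (ltn_predK j0).
by do 4 case: (a _).
Qed.

Definition step (z w : nat * nat) : bool :=
  [|| (z.1 == w.1) && (z.2 == w.2), (z.1 == w.1) && (z.2.+1 == w.2),
      (z.1 == w.1) && (z.2 == w.2.+1), (z.1.+1 == w.1) && (z.2 == w.2) |
      (z.1 == w.1.+1) && (z.2 == w.2)].

Lemma step_edge z w : step z w -> z != w -> inner_point z -> inner_point w ->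
  exists g, (gsrc g = z /\ gtgt g = w) \/ (gsrc g = w /\ gtgt g = z).
Proof.
case: z w => i j [i' j']; rewrite /step /inner_point /= => st ne.
move=> /andP[/andP[_ iM] /andP[_ jM]] /andP[/andP[_ iM'] /andP[_ jM']].
case/or4P: st => [|||/orP[]] /andP[/eqP e1 /eqP e2]; subst.
- by rewrite eqxx in ne.
- by exists (true, (Ordinal iM, Ordinal jM)); left.
- by exists (true, (Ordinal iM', Ordinal jM')); right.
- by exists (false, (Ordinal iM, Ordinal jM)); left.
- by exists (false, (Ordinal iM', Ordinal jM')); right.
Qed.

End Grid.

Section GridDrawing.
Variables (T : finType) (E : {set {set T}}).

Definition in_box (rho : nat) (z w : nat * nat) : bool :=
  [&& z.1 <= w.1 + rho, w.1 <= z.1 + rho, z.2 <= w.2 + rho & w.2 <= z.2 + rho].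

Variables (m rho : nat) (c : T -> nat * nat).
Variables (src tgt : {set T} -> T) (W : {set T} -> nat -> nat * nat).
Variable K : {set T} -> nat.

(** The vertex v stands as the box of radius rho around c v, and the edge f as the walk
W f of length K f. The walk of an edge only meets the boxes of its ends, and two walks only meet in
the box of a common end. *)
Definition grid_drawing : Prop :=
  [/\ forall f, f \in E -> [/\ f = [set src f; tgt f], src f != tgt f,
        W f 0 = c (src f) & W f (K f) = c (tgt f)],
      forall f k, f \in E -> k < K f -> step (W f k) (W f k.+1),
      forall u v z, in_box rho z (c u) -> in_box rho z (c v) -> u = v,
      forall f v k, f \in E -> k <= K f -> in_box rho (W f k) (c v) -> v \in f &
      (forall f f' j k, f \in E -> f' \in E -> f != f' -> j <= K f -> k <= K f' ->
        W f j = W f' k -> exists v, [/\ v \in f, v \in f' & in_box rho (W f j) (c v)]) /\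
      ((forall f k, f \in E -> k <= K f -> inner_point m (W f k)) /\
       (forall v z, in_box rho z (c v) -> inner_point m z))].

Hypothesis gd : grid_drawing.

Let walk_ends f : f \in E -> [/\ f = [set src f; tgt f], src f != tgt f,
  W f 0 = c (src f) & W f (K f) = c (tgt f)].
Proof. by case: gd => h _ _ _ _; exact: h. Qed.

Let box_inj u v z : in_box rho z (c u) -> in_box rho z (c v) -> u = v.
Proof. by case: gd => _ _ h _ _; exact: h. Qed.

Lemma in_box_refl z : in_box rho z z.
Proof. by rewrite /in_box !leq_addr. Qed.

(** The part of a walk before it enters the box of its target is attached to the box
of its source; what remains of the edge is one grid edge. *)
Definition before f (k : nat) : bool :=
  (k <= K f) && [forall j : 'I_k.+1, ~~ in_box rho (W f j) (c (tgt f))].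

Definition mid f z : bool := [exists k : 'I_(K f).+1, before f k && (W f k == z)].

(** The fibre of v consists of the box of v and of the beginnings of the walks that
leave it. *)
Definition label (z : nat * nat) : option T :=
  if [pick v | in_box rho z (c v)] is Some v then Some v
  else omap src [pick f in E | mid f z].

Lemma label_box z v : in_box rho z (c v) -> label z = Some v.
Proof.
rewrite /label => zv; case: pickP => [u zu|/(_ v)]; last by rewrite zv.
by rewrite (box_inj zu zv).
Qed.

Lemma label_mid f k : f \in E -> before f k -> label (W f k) = Some (src f).
Proof.
move=> fE /andP[kK /forallP hb]; rewrite /label.
have ntgt : ~~ in_box rho (W f k) (c (tgt f)) by have := hb ord_max.
case: gd => _ _ _ hv [hff _].
case: pickP => [v zv|nobox].
  have [ef _ _ _] := walk_ends fE.
  have : v \in [set src f; tgt f] by rewrite -ef; exact: hv fE kK zv.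
  rewrite !inE => /orP[/eqP->//|/eqP ev].
  by rewrite -ev zv in ntgt.
have fm : mid f (W f k).
  have kK' : k < (K f).+1 by [].
  apply/existsP; exists (Ordinal kK'); rewrite eqxx andbT /before /= kK.
  exact/forallP.
case: pickP => [f' /andP[fE' /existsP[j /andP[/andP[jK _] /eqP ej]]]|/(_ f)].
  case: (eqVneq f f') => [->//|ff'].
  have [v [_ _ zv]] := hff _ _ _ _ fE fE' ff' kK jK (esym ej).
  by have := nobox v; rewrite zv.
by rewrite fE fm.
Qed.

Lemma labelP z x : label z = Some x ->
  in_box rho z (c x) \/ exists f k, [/\ f \in E, before f k, z = W f k & x = src f].
Proof.
rewrite /label; case: pickP => [v zv [<-]|_]; first by left.
case: pickP => [f /andP[fE /existsP[k /andP[bk /eqP ek]]] [<-]|//].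
by right; exists f, k.
Qed.

Lemma label_interior z : label z -> inner_point m z.
Proof.
case: gd => _ _ _ _ [_ [hW hbox]].
case ez: (label z) => [x|//] _; have [/hbox//|[f [k [fE /andP[kK _] -> _]]]] := labelP ez.
exact: hW.
Qed.

Definition linked x p q : Prop :=
  exists d : grid_edge m -> bool,
    (forall g, d g -> label (gsrc g) = Some x /\ label (gtgt g) = Some x) /\
    forall z, chain_bd (@gsrc m) (@gtgt m) d z = (p == z) (+) (q == z).

Lemma linked_refl x p : linked x p p.
Proof. by exists (fun=> false); split=> // z; rewrite chain_bd0 addbb. Qed.

Lemma linked_sym x p q : linked x p q -> linked x q p.
Proof. by move=> [d [h e]]; exists d; split=> // z; rewrite e addbC. Qed.

Lemma linked_trans x p q z : linked x p q -> linked x q z -> linked x p z.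
Proof.
move=> [d [h e]] [d' [h' e']]; exists (fun g => d g (+) d' g); split.
  by move=> g; case: (boolP (d g)) => [/h//|_ /=] /h'.
by move=> y; rewrite chain_bdD e e'; case: (p == y); case: (q == y); case: (z == y).
Qed.

Lemma linked_step x p q : label p = Some x -> label q = Some x -> step p q ->
  linked x p q.
Proof.
move=> lp lq st; case: (eqVneq p q) => [->|pq]; first exact: linked_refl.
have [ip iq] : inner_point m p /\ inner_point m q by split; apply: label_interior; rewrite ?lp ?lq.
have [g hg] := step_edge st pq ip iq.
exists (fun h => h == g); split.
  by move=> h /eqP->; case: hg => -[-> ->].
by move=> z; rewrite chain_bd1; case: hg => -[-> ->] //; rewrite addbC.
Qed.

(** A box is connected by horizontal and vertical moves towards its middle. *)
Lemma linked_box x z : in_box rho z (c x) -> linked x z (c x).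
Proof.
pose dist z := (z.1 - (c x).1) + ((c x).1 - z.1) + ((z.2 - (c x).2) + ((c x).2 - z.2)).
have [n] := ubnP (dist z); elim: n => // n IHn in z * => dz zx.
have go w : in_box rho w (c x) -> step z w -> dist w < dist z -> linked x z (c x).
  move=> wx st dw; apply: (linked_trans (linked_step _ _ st)); try exact: label_box.
  by apply: IHn => //; exact: leq_trans dw dz.
case: z dz zx go => i j; rewrite /dist /in_box /step /=; case: (c x) => ci cj /=.
move=> _ /and4P[h1 h2 h3 h4] go.
case: (ltngtP i ci) => hi.
- apply: (go (i.+1, j)) => /=; [apply/and4P; split; lia | by rewrite !eqxx !orbT | lia].
- apply: (go (i.-1, j)) => /=; [apply/and4P; split; lia | | lia].
  by rewrite (ltn_predK hi) !eqxx !orbT.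
case: (ltngtP j cj) => hj.
- apply: (go (i, j.+1)) => /=; [apply/and4P; split; lia | by rewrite !eqxx !orbT | lia].
- apply: (go (i, j.-1)) => /=; [apply/and4P; split; lia | | lia].
  by rewrite (ltn_predK hj) !eqxx !orbT.
rewrite hi hj; exact: linked_refl.
Qed.

Lemma linked_walk f k : f \in E -> before f k -> linked (src f) (W f k) (c (src f)).
Proof.
move=> fE; have [_ _ W0 _] := walk_ends fE.
elim: k => [|k IHk] bk; first by rewrite W0; exact: linked_refl.
have bk' : before f k.
  case/andP: bk => kK /forallP h; rewrite /before (ltnW kK).
  by apply/forallP => j; exact: (h (widen_ord (leqnSn _) j)).
apply: linked_trans (IHk bk'); apply: linked_sym.
apply: linked_step; try exact: label_mid.
by case: gd => _ h _ _ _; apply: h => //; case/andP: bk.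
Qed.

Lemma linked_label x p : label p = Some x -> linked x p (c x).
Proof.
by move=> /labelP[/linked_box//|[f [k [fE bk -> ->]]]]; exact: linked_walk.
Qed.

(** The step by which the walk enters the box of its target for the first time. *)
Lemma crossing_edge f : f \in E -> exists g : grid_edge m, exists x y,
  [/\ f = [set x; y], x != y, label (gsrc g) = Some x & label (gtgt g) = Some y].
Proof.
move=> fE; have [ef st W0 WK] := walk_ends fE.
have hit : exists k, (k <= K f) && in_box rho (W f k) (c (tgt f)).
  by exists (K f); rewrite leqnn WK in_box_refl.
have [k /andP[kK hk] kmin] := ex_minnP hit.
case: k kK hk kmin => [|k] kK hk kmin.
  by move: st; rewrite W0 in hk; rewrite (box_inj (in_box_refl _) hk) eqxx.
have lk : label (W f k) = Some (src f).
  apply: label_mid => //; rewrite /before (ltnW kK); apply/forallP => j.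
  apply/negP => hj; have := kmin j; rewrite hj andbT.
  have jk := ltn_ord j; rewrite (leq_trans _ (ltnW kK)) // => /(_ isT).
  by rewrite leqNgt jk.
have lk1 := label_box hk.
have kk : W f k != W f k.+1.
  by apply: contraNneq st => e; rewrite e lk1 in lk; case: lk => ->.
have sk : step (W f k) (W f k.+1) by case: gd => _ h _ _ _; exact: h.
have [ip iq] : inner_point m (W f k) /\ inner_point m (W f k.+1).
  by split; apply: label_interior; rewrite ?lk ?lk1.
have [g [[e1 e2]|[e1 e2]]] := step_edge sk kk ip iq; exists g.
  by exists (src f), (tgt f); rewrite e1 e2.
by exists (tgt f), (src f); rewrite e1 e2 setUC eq_sym.
Qed.

Theorem grid_drawing_dual : has_dual E.
Proof.
pose crossing f (g : grid_edge m) := f \in E -> exists x y,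
  [/\ f = [set x; y], x != y, label (gsrc g) = Some x & label (gtgt g) = Some y].
have [eps heps] : {eps : {set T} -> grid_edge m & forall f, crossing f (eps f)}.
  apply: (@choice _ _ crossing) => f.
  case: (boolP (f \in E)) => fE; first by have [g hg] := crossing_edge fE; exists g.
  by exists (false, (ord0, ord0)); rewrite /crossing (negbTE fE).
apply: (@minor_has_dual T (grid_edge m) (grid_face m) _ (0, 0) (@gsrc m) (@gtgt m)
  (@gleft m) (@gright m) label eps E).
- exact: grid_exact.
- by move=> a p /label_interior; exact: grid_cut_closed.
- move=> x p q lp lq.
  exact: linked_trans (linked_label lp) (linked_sym (linked_label lq)).
- exact: heps.
Qed.

End GridDrawing.

From mathcomp Require Import all_boot all_order all_algebra.
From mathcomp Require Import all_classical all_reals all_analysis.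
From mathcomp Require Import lra.

Import Order.TTheory GRing.Theory Num.Theory.
Import numFieldNormedType.Exports.
Local Open Scope classical_set_scope.
Local Open Scope ring_scope.

(** * Compact sets in the plane *)

Section Plane.
Variable R : realType.
Implicit Types (p q : R * R) (K L : set (R * R)).

Lemma norm_pair p : `|p| = Num.max `|p.1| `|p.2|.
Proof. by []. Qed.

Lemma dist_continuous : continuous (fun x : (R * R) * (R * R) => `|x.1 - x.2|).
Proof.
move=> x; apply: (@continuous_comp _ _ _ (fun x : (R * R) * (R * R) => x.1 - x.2) Num.norm).
  exact: sub_continuous.
exact: norm_continuous.
Qed.

(** The distance attains its minimum on the product of the two compact sets. *)
Lemma compact_dist K L : compact K -> compact L -> K `&` L = set0 ->
  exists2 e : R, 0 < e & forall p q, K p -> L q -> e <= `|p - q|.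
Proof.
move=> cK cL KL0.
have [[[p q] [Kp Lq]]|none] := pselect (exists x : (R * R) * (R * R), (K `*` L) x).
  have KL : (K `*` L) !=set0 by exists (p, q).
  have cont : {within K `*` L, continuous (fun x : (R * R) * (R * R) => `|x.1 - x.2|)}.
    by apply: continuous_subspaceT => x; exact: dist_continuous.
  have [[p0 q0]] := compact_EVT_min KL (compact_setX cK cL) cont.
  rewrite inE => -[/= Kp0 Lq0] min0; exists `|p0 - q0|.
    rewrite normr_gt0 subr_eq0; apply/eqP => e.
    have : (K `&` L) p0 by split=> //; rewrite e.
    by rewrite KL0.
  by move=> p1 q1 K1 L1; apply: (min0 (p1, q1)); rewrite inE.
exists 1; first exact: ltr01.
by move=> p q Kp Lq; case: none; exists (p, q).
Qed.

(** Uniform continuity on the unit interval, from the covering form of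
compactness. *)
Lemma arc_mesh (g : R -> R * R) (e : R) : {within `[0, 1], continuous g} -> 0 < e ->
  exists n : nat, forall k, (k <= n)%N ->
    `|g (k%:R / n.+1%:R) - g (k.+1%:R / n.+1%:R)| < e.
Proof.
move=> cg e0; have c01 : compact (`[0, 1] : set R) by exact: segment_compact.
have e20 : 0 < e / 2 by rewrite divr_gt0.
have /compact_near_coveringP/(_ R (0^'+) (fun d s => s \in `[0, 1] -> forall t, t \in `[0, 1] ->
   `|s - t| < d -> `|g s - g t| < e)) := c01.
have cov : forall x : R, [set` `[0, 1]] x ->
    \forall s \near x & d \near (0:R)^'+, s \in `[0, 1] -> forall t, t \in `[0, 1] ->
   `|s - t| < d -> `|g s - g t| < e.
  move=> x x01.
  move/subspace_continuousP: cg => /(_ x x01)/cvgrPdist_lt/(_ _ e20).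
  rewrite near_withinE => /nbhs_normP[eta /= eta0 heta].
  near=> s d => s01 t t01 std.
  have close u : u \in `[0, 1] -> `|x - u| < eta -> `|g x - g u| < e / 2.
    by move=> u01 xu; apply: (heta u xu); rewrite /= in u01 *.
  have xs : `|x - s| < eta / 2.
    by near: s; apply/nbhs_normP; exists (eta / 2) => //=; rewrite divr_gt0.
  have de : d < eta / 2.
    by near: d; apply: nbhs_right_lt; rewrite divr_gt0.
  have xs' : `|x - s| < eta by apply: lt_le_trans xs _; lra.
  have xt : `|x - t| < eta.
    have -> : x - t = (x - s) + (s - t) by lra.
    apply: le_lt_trans (ler_normD _ _) _; rewrite [ltRHS]splitr.
    by apply: ltrD => //; exact: lt_trans std de.
  have -> : g s - g t = (g x - g t) - (g x - g s) by rewrite opprB [RHS]addrC addrA subrK.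
  apply: le_lt_trans (ler_normB _ _) _; rewrite [ltRHS]splitr.
  by apply: ltrD; exact: close.
move=> /(_ _ cov) hd.
near (0 : R)^'+ => d.
have d0 : 0 < d by near: d; exact: nbhs_right_gt.
have mesh : [set` `[0, 1]] `<=` (fun s => s \in `[0, 1] -> forall t, t \in `[0, 1] ->
    `|s - t| < d -> `|g s - g t| < e) by near: d.
pose n := Num.truncn d^-1; exists n => k kn.
have n0 : 0 < n.+1%:R :> R by rewrite ltr0n.
have in01 j : (j <= n.+1)%N -> (j%:R / n.+1%:R : R) \in `[0, 1].
  by move=> jn; rewrite in_itv /= divr_ge0 // ler_pdivrMr // mul1r ler_nat.
apply: (mesh (k%:R / n.+1%:R)).
- by apply: in01; exact: leqW.
- by apply: in01; exact: leqW.
- by apply: in01.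
rewrite -mulrBl -natr1 opprD addrA subrr add0r mulN1r normrN ger0_norm ?invr_ge0 //.
by rewrite invf_plt ?posrE // truncnS_gt.
Unshelve. all: by end_near.
Qed.

Lemma fin_small (J : finType) (P : J -> R -> Prop) :
  (forall j, exists2 e : R, 0 < e & forall e', 0 < e' <= e -> P j e') ->
  exists2 e : R, 0 < e & forall j e', 0 < e' <= e -> P j e'.
Proof.
move=> hP.
suff [e e0 he] : exists2 e : R, 0 < e & forall j, j \in enum J -> forall e', 0 < e' <= e -> P j e'.
  by exists e => // j e' /he; apply; rewrite mem_enum.
elim: (enum J) => [|j s [e e0 he]]; first by exists 1.
have [d d0 hd] := hP j; exists (Num.min e d); first by rewrite lt_min e0.
move=> i; rewrite inE => /orP[/eqP->|/he h] e'; rewrite le_min => /and3P[p0 p1 p2].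
  by apply: hd; rewrite p0.
by apply: h; rewrite p0.
Qed.

Lemma fin_large (J : finType) (P : J -> R -> Prop) :
  (forall j, exists b : R, forall b', b <= b' -> P j b') ->
  exists b : R, forall j b', b <= b' -> P j b'.
Proof.
move=> hP.
suff [b hb] : exists b : R, forall j, j \in enum J -> forall b', b <= b' -> P j b'.
  by exists b => j b' /hb; apply; rewrite mem_enum.
elim: (enum J) => [|j s [e he]]; first by exists 1.
have [d hd] := hP j; exists (Num.max e d).
move=> i; rewrite inE => /orP[/eqP->|/he h] e'; rewrite ge_max => /andP[p1 p2].
  exact: hd.
exact: h.
Qed.

Lemma arc_compact (A : set (R * R)) p q : is_arc A p q -> compact A.
Proof.
move=> [g [cg _ _ _ ->]]; apply: continuous_compact => //.
exact: segment_compact.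
Qed.

(** The points of A at distance at least r from the common ends form a compact set
disjoint from B. *)
Lemma arcs_apart (T : finType) (pos : T -> R * R) (A B : set (R * R))
    (C : {set T}) (r : R) : compact A -> compact B -> 0 < r ->
    A `&` B `<=` [set pos z | z in [set` C]] ->
  exists2 e, 0 < e & forall p q, A p -> B q -> `|p - q| < e ->
    exists2 v, v \in C & `|p - pos v| < r.
Proof.
move=> cA cB r0 AB.
pose far v : set (R * R) := [set p | r <= `|p - pos v|].
have cfar v : closed (far v).
  apply: (@closed_comp _ _ (fun p => `|p - pos v|) [set x | r <= x]); last exact: closed_ge.
  move=> p _; apply: (@continuous_comp _ _ _ (fun p => p - pos v) Num.norm).
    by apply: cvgB; [exact: cvg_id | exact: cvg_cst].
  exact: norm_continuous.
have cK : compact (A `&` \bigcap_(v in [set` C]) far v).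
  by apply: compact_closedI => //; apply: closed_bigI => v _.
have [|e e0 he] := compact_dist cK cB.
  rewrite -subset0 => p [[Ap fp] Bp]; have [v vC ev] := AB p (conj Ap Bp).
  have := fp v vC; rewrite /far /= ev subrr normr0 leNgt r0.
  by [].
exists e => // p q Ap Bq; apply: contraPP => none; apply/negP; rewrite -leNgt.
apply: he => //; split=> // v /= vC; rewrite /far /= leNgt; apply/negP => h.
by apply: none; exists v.
Qed.

End Plane.

(** * From plane drawings to grid drawings *)

Section Cells.
Variables (R : realType) (N : nat) (B : R).
Hypothesis N0 : (0 < N)%N.
Implicit Types (p q : R * R).

Definition scale (x : R) : R := N%:R * (x + B).
Definition cellc (x : R) : nat := Num.truncn (scale x).
Definition cell p : nat * nat := (cellc p.1, cellc p.2).

Lemma cellcP x : 0 <= x + B -> (cellc x)%:R <= scale x < (cellc x)%:R + 1.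
Proof.
move=> xB; have := @truncn_itv R (scale x); rewrite -natr1; apply.
by rewrite mulr_ge0.
Qed.

Lemma scaleB x y : scale x - scale y = N%:R * (x - y).
Proof. by rewrite /scale -mulrBr opprD addrACA subrr addr0. Qed.

Lemma scale_lt p q (t : R) : `|scale p.1 - scale q.1| < N%:R * t ->
  `|scale p.2 - scale q.2| < N%:R * t -> `|p - q| < t.
Proof.
have N0' : 0 < N%:R :> R by rewrite ltr0n.
by rewrite !scaleB !normrM !(gtr0_norm N0') !(ltr_pM2l N0') norm_pair gt_max => -> ->.
Qed.

Lemma scale_lt1 p q (t : R) : `|p - q| < t -> `|scale p.1 - scale q.1| < N%:R * t.
Proof.
have N0' : 0 < N%:R :> R by rewrite ltr0n.
by rewrite scaleB normrM (gtr0_norm N0') (ltr_pM2l N0') norm_pair gt_max => /andP[].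
Qed.

Lemma scale_lt2 p q (t : R) : `|p - q| < t -> `|scale p.2 - scale q.2| < N%:R * t.
Proof.
have N0' : 0 < N%:R :> R by rewrite ltr0n.
by rewrite scaleB normrM (gtr0_norm N0') (ltr_pM2l N0') norm_pair gt_max => /andP[].
Qed.

Lemma in_boxP (rho : nat) (z w : nat * nat) : in_box rho z w =
  (`|z.1%:R - w.1%:R| <= rho%:R :> R) && (`|z.2%:R - w.2%:R| <= rho%:R :> R).
Proof.
rewrite !ler_distl /in_box -!(ler_nat R) !natrD !lerBlDr.
by rewrite andbA [X in X && _]andbC -!andbA; congr (_ && (_ && _)); rewrite andbC.
Qed.

Lemma cell_step x y z : 0 <= x + B -> 0 <= y + B -> `|scale x - scale y| < 1 ->
  step (cellc x, z) (cellc y, z) && step (z, cellc x) (z, cellc y).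
Proof.
move=> /cellcP/andP[x1 x2] /cellcP/andP[y1 y2]; rewrite ltr_norml => /andP[d1 d2].
have h1 : (cellc x <= cellc y + 1)%N.
  by rewrite -ltnS -(ltr_nat R) -natr1 natrD; lra.
have h2 : (cellc y <= cellc x + 1)%N.
  by rewrite -ltnS -(ltr_nat R) -natr1 natrD; lra.
by rewrite /step /= eqxx /=; apply/andP; split; lia.
Qed.

End Cells.

Section Discretise.
Variables (R : realType) (T : finType) (E : {set {set T}}).
Variables (pos : T -> R * R) (arc : {set T} -> set (R * R)) (x0 : T).
Hypothesis sE : simple_graph E.
Hypothesis drawing : plane_drawing E pos arc.
Implicit Types (f : {set T}) (p q : R * R).

Let curve_data f (d : T * T * (R -> R * R)) : Prop := f \in E ->
  [/\ f = [set d.1.1; d.1.2]%SET, d.1.1 != d.1.2, {within `[0, 1], continuous d.2},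
      d.2 0 = pos d.1.1 & d.2 1 = pos d.1.2 /\ arc f = d.2 @` `[0, 1]].

(** Drawings only give a curve for each way of writing an edge as a pair; one of them
is chosen. *)
Lemma curves : {d : {set T} -> T * T * (R -> R * R) & forall f, curve_data f (d f)}.
Proof.
apply: (@choice _ _ curve_data) => f.
case: (boolP (f \in E)) => fE; last first.
  by exists (x0, x0, fun=> pos x0); rewrite /curve_data (negbTE fE).
have /eqP/cards2P[x [y [xy ef]]] := sE fE.
have [_ harc _ _] := drawing; subst f.
have [g [cg _ g0 g1 eg]] := harc _ _ fE.
by exists (x, y, g).
Qed.

Lemma edge_arc_compact f : f \in E -> compact (arc f).
Proof.
move=> fE; have /eqP/cards2P[x [y [xy ef]]] := sE fE; subst f.
by have [_ harc _ _] := drawing; exact: arc_compact (harc _ _ fE).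
Qed.

Lemma vertex_gap : exists2 s : R, 0 < s &
  (forall u v, u != v -> s <= `|pos u - pos v|) /\
  (forall f v p, f \in E -> v \notin f -> arc f p -> s <= `|p - pos v|).
Proof.
have [pinj _ hv _] := drawing.
have [|s1 s10 h1] := @fin_small R (T * T)%type
  (fun uv e => uv.1 != uv.2 -> e <= `|pos uv.1 - pos uv.2|).
  move=> [u v] /=; case: (eqVneq u v) => uv; first by exists 1.
  exists `|pos u - pos v|; last by move=> e' /andP[].
  by rewrite normr_gt0 subr_eq0; apply: contraNneq uv => /pinj ->.
have [|s2 s20 h2] := @fin_small R ({set T} * T)%type
  (fun fv e => fv.1 \in E -> fv.2 \notin fv.1 -> forall p, arc fv.1 p -> e <= `|p - pos fv.2|).
  move=> [f v] /=; case: (boolP (f \in E)) => fE; last by exists 1.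
  case: (boolP (v \in f)) => vf; first by exists 1.
  have [|e e0 he] := compact_dist (edge_arc_compact fE) (@compact_set1 _ (pos v)).
    by rewrite -subset0 => p [fp /= ep]; move/negP: vf; apply; apply: hv => //; rewrite -ep.
  by exists e => // e' /andP[_ le] _ _ p fp; apply: le_trans le _; exact: he.
exists (Num.min s1 s2); first by rewrite lt_min s10.
have m0 : 0 < Num.min s1 s2 by rewrite lt_min s10.
split=> [u v uv|f v p fE vf fp].
  by apply: (h1 (u, v)) => //; rewrite m0 ge_min lexx.
by apply: (h2 (f, v)) => //; rewrite m0 ge_min lexx orbT.
Qed.

Lemma edge_gap (r : R) : 0 < r -> exists2 e : R, 0 < e & forall f f' p q,
  f \in E -> f' \in E -> f != f' -> arc f p -> arc f' q -> `|p - q| < e ->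
  exists v, [/\ v \in f, v \in f' & `|p - pos v| < r].
Proof.
move=> r0; have [_ _ _ hff] := drawing.
have [|e e0 he] := @fin_small R ({set T} * {set T})%type (fun ff e =>
  ff.1 \in E -> ff.2 \in E -> ff.1 != ff.2 -> forall p q, arc ff.1 p -> arc ff.2 q ->
  `|p - q| < e -> exists v, [/\ v \in ff.1, v \in ff.2 & `|p - pos v| < r]).
  move=> [f f'] /=; case: (boolP (f \in E)) => fE; last by exists 1.
  case: (boolP (f' \in E)) => fE'; last by exists 1.
  case: (eqVneq f f') => ff; first by exists 1.
  have [e e0 he] := arcs_apart (edge_arc_compact fE) (edge_arc_compact fE') r0
    (hff _ _ fE fE' ff).
  exists e => // e' /andP[_ le] _ _ _ p q fp fq pq.
  have [v + pv] := he _ _ fp fq (lt_le_trans pq le).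
  by rewrite inE => /andP[vf vf']; exists v.
exists e => // f f' p q fE fE' ff; apply: (he (f, f') e) => //.
by rewrite e0 lexx.
Qed.

Lemma drawing_bounded : exists b : R, (forall v, `|pos v| <= b) /\
  forall f p, f \in E -> arc f p -> `|p| <= b.
Proof.
have [|b1 h1] := @fin_large R T (fun v b => `|pos v| <= b).
  by move=> v; exists `|pos v|.
have [|b2 h2] := @fin_large R {set T} (fun f b => f \in E -> forall p, arc f p -> `|p| <= b).
  move=> f; case: (boolP (f \in E)) => fE; last by exists 0.
  have /ex_strict_bound_gt0[k _ hk] := compact_bounded (edge_arc_compact fE).
  by exists k => b kb _ p fp; apply: le_trans kb; apply/ltW; exact: hk.
exists (Num.max b1 b2); split=> [v|f p].
  by apply: h1; rewrite le_max lexx.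
by move=> fE fp; apply: (h2 f _ _ fE p fp); rewrite le_max lexx orbT.
Qed.

(** With s the gap between a vertex and whatever is not incident to it, boxes have
radius about s / 3 in the plane. Points of two edges that are closer than the gap e
are at distance less than s / 6 from a common end. The grid is taken so fine that
the errors made by passing from points to cells, a few units, are negligible
compared with s / 6 and with e. *)
Theorem planar_grid_drawing : exists m rho c src tgt W K,
  @grid_drawing T E m rho c src tgt W K.
Proof.
have [d hd] := curves.
have [s s0 [huv hfv]] := vertex_gap.
pose r := s / 6; have r0 : 0 < r by rewrite divr_gt0.
have [e e0 hff] := edge_gap r0.
have [b [hbv hbf]] := drawing_bounded.
have b0 : 0 <= b by apply: le_trans (hbv x0).
(* The number of cells per unit of length: the gaps r and e exceed 10 cells. *)
pose N := (Num.truncn (10 / r + 10 / e + 2)).+1.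
have hN : 10 / r + 10 / e + 2 < N%:R by rewrite truncnS_gt.
have [r10 e10] : 0 < 10 / r /\ 0 < 10 / e by split; rewrite divr_gt0.
have N0 : (0 < N)%N by [].
have N0' : 0 < N%:R :> R by rewrite ltr0n.
pose Rr : R := N%:R * r.
have Rr10 : 10 < Rr by rewrite /Rr -ltr_pdivrMr //; lra.
have Re10 : 10 < N%:R * e by rewrite -ltr_pdivrMr //; lra.
have Rs : N%:R * s = 6 * Rr by rewrite /Rr /r; lra.
(* The shift by B keeps the boxes away from the coordinate axes. *)
pose B := b + 2 * r + 1.
have hB x : `|x| <= b -> 0 <= x + B.
  by rewrite /B ler_norml => /andP[]; lra.
have sB x : `|x| <= b -> 2 * Rr + 2 <= scale N B x <= N%:R * (2 * B).
  rewrite /scale ler_norml => /andP[h1 h2]; apply/andP; split; last first.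
    by rewrite ler_pM2l // /B; lra.
  have -> : 2 * Rr + 2 = N%:R * (2 * r + 2 / N%:R).
    by rewrite mulrDr (mulrC _ (2 / _)) divfK ?gt_eqF // mulrCA.
  rewrite ler_pM2l //; have : 2 / N%:R <= 1 :> R by rewrite ler_pdivrMr // mul1r; lra.
  by rewrite /B; lra.
pose rho := Num.truncn (2 * Rr).
have /andP[rho1 rho2] : rho%:R <= 2 * Rr < rho%:R + 1.
  by rewrite natr1; apply: truncn_itv; lra.
pose m := (Num.truncn (N%:R * (2 * B)) + rho + 5)%N.
have B0 : 0 <= N%:R * (2 * B) by rewrite mulr_ge0 // /B; lra.
have /andP[_ m1] := truncn_itv B0; rewrite -natr1 in m1.
have mE : m%:R = (Num.truncn (N%:R * (2 * B)))%:R + rho%:R + 5 :> R.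
  by rewrite /m !natrD.
have mesh f : exists n : nat, f \in E -> forall k, (k <= n)%N ->
    `|(d f).2 (k%:R / n.+1%:R) - (d f).2 (k.+1%:R / n.+1%:R)| < N%:R^-1.
  case: (boolP (f \in E)) => fE; last by exists 0%N.
  have [_ _ cg _ _] := hd f fE.
  by have [||n hn] := @arc_mesh R (d f).2 N%:R^-1; rewrite ?invr_gt0 //; exists n.
have [n hn] := @choice _ _ (fun f n => f \in E -> forall k, (k <= n)%N ->
    `|(d f).2 (k%:R / n.+1%:R) - (d f).2 (k.+1%:R / n.+1%:R)| < N%:R^-1) mesh.
pose pt f k := (d f).2 (k%:R / (n f).+1%:R).
(* Between two consecutive sample points, one coordinate is changed at a time. *)
pose W f k := if odd k then (cellc N B (pt f k./2.+1).1, cellc N B (pt f k./2).2)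
  else cell N B (pt f k./2).
pose K f := (n f).+1.*2.
pose c v := cell N B (pos v).
have arc_pt f k : f \in E -> (k <= (n f).+1)%N -> arc f (pt f k).
  move=> fE kn; have [_ _ _ _ [_ ->]] := hd f fE.
  exists (k%:R / (n f).+1%:R) => //=.
  by rewrite in_itv /= divr_ge0 // ler_pdivrMr ?ltr0n // mul1r ler_nat.
have pt_close f k : f \in E -> (k <= n f)%N ->
    `|scale N B (pt f k).1 - scale N B (pt f k.+1).1| < 1 /\
    `|scale N B (pt f k).2 - scale N B (pt f k.+1).2| < 1.
  move=> fE kn; have h := hn f fE k kn.
  rewrite -[1](@divff _ (N%:R : R)) ?gt_eqF //.
  by split; [exact: scale_lt1 h | exact: scale_lt2 h].
have arc_le f p : f \in E -> arc f p -> `|p.1| <= b /\ `|p.2| <= b.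
  by move=> fE /(hbf _ _ fE); rewrite norm_pair ge_max => /andP[].
have bv v : `|(pos v).1| <= b /\ `|(pos v).2| <= b.
  by have := hbv v; rewrite norm_pair ge_max => /andP[].
have cellb x : `|x| <= b -> (cellc N B x)%:R <= scale N B x < (cellc N B x)%:R + 1.
  by move=> /hB; exact: cellcP.
have W_close f k : f \in E -> (k <= K f)%N -> exists p, [/\ arc f p,
    `|(W f k).1%:R - scale N B p.1| <= 2 & `|(W f k).2%:R - scale N B p.2| <= 2].
  move=> fE kK; have := odd_double_half k; rewrite /W; case: ifP => ok /= ek; last first.
    have kn : (k./2 <= (n f).+1)%N by rewrite leq_half_double (leq_trans kK).
    have ap := arc_pt f k./2 fE kn; exists (pt f k./2); split=> //.
      have [/cellb/andP[h1 h2] _] := arc_le _ _ fE ap.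
      by rewrite ler_norml; clear - h1 h2; apply/andP; split; lra.
    have [_ /cellb/andP[h1 h2]] := arc_le _ _ fE ap.
    by rewrite ler_norml; clear - h1 h2; apply/andP; split; lra.
  have kn : (k./2 <= n f)%N.
    rewrite -ltnS ltn_half_double ltn_neqAle -/(K f) kK andbT.
    by apply: contraTneq ok => ->; rewrite odd_double.
  have ap := arc_pt f k./2 fE (leqW kn); have aq := arc_pt f k./2.+1 fE kn.
  exists (pt f k./2); split=> //.
    have [+ _] := pt_close _ _ fE kn; rewrite ltr_norml => /andP[g1 g2].
    have [/cellb/andP[h1 h2] _] := arc_le _ _ fE aq.
    by rewrite ler_norml; clear - h1 h2 g1 g2; apply/andP; split; lra.
  have [_ /cellb/andP[h1 h2]] := arc_le _ _ fE ap.
  by rewrite ler_norml; clear - h1 h2; apply/andP; split; lra.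
exists m, rho, c, (fun f => (d f).1.1), (fun f => (d f).1.2), W, K; split.
- move=> f fE; have [ef st _ g0 [g1 _]] := hd f fE; split=> //.
    by rewrite /W /= /pt mul0r g0.
  by rewrite /W /K odd_double doubleK /pt divff ?g1 // pnatr_eq0.
- move=> f k fE kK; have := odd_double_half k; rewrite /W /= uphalf_half.
  case: ifP => ok /= ek.
    have kn : (k./2 <= n f)%N by rewrite -ltnS ltn_half_double.
    have [_ h2] := pt_close _ _ fE kn.
    have [_ /hB p2] := arc_le _ _ fE (arc_pt _ _ fE (leqW kn)).
    have [_ /hB q2] := arc_le _ _ fE (arc_pt _ k./2.+1 fE kn).
    rewrite add1n.
    by have /andP[_] := cell_step N0 (cellc N B (pt f k./2.+1).1) p2 q2 h2.
  have kn : (k./2 <= n f)%N by rewrite -ltnS ltn_half_double.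
  have [h1 _] := pt_close _ _ fE kn.
  have [/hB p1 _] := arc_le _ _ fE (arc_pt _ _ fE (leqW kn)).
  have [/hB q1 _] := arc_le _ _ fE (arc_pt _ k./2.+1 fE kn).
  rewrite add0n.
  by have /andP[] := cell_step N0 (cellc N B (pt f k./2).2) p1 q1 h1.
- move=> u v z; rewrite !(in_boxP R) !ler_norml => /andP[/andP[a1 a2] /andP[a3 a4]].
  move=> /andP[/andP[c1 c2] /andP[c3 c4]].
  have [/cellb/andP[u1 u2] /cellb/andP[u3 u4]] := bv u.
  have [/cellb/andP[v1 v2] /cellb/andP[v3 v4]] := bv v.
  apply/eqP; apply: contraT => uv.
  have := huv _ _ uv; rewrite leNgt => /negP[]; apply: (scale_lt N0 (B := B)).
    rewrite Rs ltr_norml; clear - a1 a2 c1 c2 u1 u2 v1 v2 rho1 Rr10.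
    by rewrite /= in a1 a2 c1 c2; apply/andP; split; lra.
  rewrite Rs ltr_norml; clear - a3 a4 c3 c4 u3 u4 v3 v4 rho1 Rr10.
  by rewrite /= in a3 a4 c3 c4; apply/andP; split; lra.
- move=> f v k fE kK; rewrite (in_boxP R) !ler_norml => /andP[/andP[a1 a2] /andP[a3 a4]].
  have [p [ap]] := W_close _ _ fE kK; rewrite !ler_norml => /andP[b1 b2] /andP[b3 b4].
  have [/cellb/andP[v1 v2] /cellb/andP[v3 v4]] := bv v.
  apply: contraT => vf; have := hfv _ _ _ fE vf ap; rewrite leNgt => /negP[].
  apply: (scale_lt N0 (B := B)); rewrite Rs ltr_norml.
    clear - a1 a2 b1 b2 v1 v2 rho1 Rr10.
    by rewrite /= in a1 a2; apply/andP; split; lra.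
  clear - a3 a4 b3 b4 v3 v4 rho1 Rr10.
  by rewrite /= in a3 a4; apply/andP; split; lra.
split.
  move=> f f' j k fE fE' ff jK kK e12.
  have [p [ap]] := W_close _ _ fE jK; rewrite !ler_norml => /andP[b1 b2] /andP[b3 b4].
  have [q [aq]] := W_close _ _ fE' kK; rewrite -e12 !ler_norml => /andP[c1 c2] /andP[c3 c4].
  have [|v [vf vf' pv]] := hff _ _ _ _ fE fE' ff ap aq.
    apply: (scale_lt N0 (B := B)); rewrite ltr_norml.
      by clear - b1 b2 c1 c2 Re10; apply/andP; split; lra.
    by clear - b3 b4 c3 c4 Re10; apply/andP; split; lra.
  exists v; split=> //; rewrite (in_boxP R).
  have [/cellb/andP[v1 v2] /cellb/andP[v3 v4]] := bv v.
  have := scale_lt1 B N0 pv; have := scale_lt2 B N0 pv; rewrite -/Rr !ltr_norml.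
  move=> /andP[g1 g2] /andP[g3 g4].
  rewrite !ler_norml /=; apply/andP; split; apply/andP.
    by clear - b1 b2 g3 g4 v1 v2 rho2 Rr10; split; lra.
  by clear - b3 b4 g1 g2 v3 v4 rho2 Rr10; split; lra.
have inter z : 0 < z.1%:R :> R -> z.1%:R < m.+1%:R :> R ->
    0 < z.2%:R :> R -> z.2%:R < m.+1%:R :> R -> inner_point m z.
  by rewrite !ltr0n !ltr_nat /inner_point => -> -> -> ->.
split.
  move=> f k fE kK.
  have [p [ap]] := W_close _ _ fE kK; rewrite !ler_norml => /andP[b1 b2] /andP[b3 b4].
  have [/sB/andP[p1 p2] /sB/andP[p3 p4]] := arc_le _ _ fE ap.
  apply: inter; rewrite -?natr1 ?mE.
  - by clear - b1 p1 Rr10; lra.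
  - have := ler0n R rho; clear - b2 p2 m1 mE; lra.
  - by clear - b3 p3 Rr10; lra.
  - have := ler0n R rho; clear - b4 p4 m1 mE; lra.
move=> v z; rewrite (in_boxP R) !ler_norml => /andP[/andP[a1 a2] /andP[a3 a4]].
have [q1 q2] := bv v.
have /andP[v1 v2] := cellb _ q1; have /andP[v3 v4] := cellb _ q2.
have /andP[p1 p2] := sB _ q1; have /andP[p3 p4] := sB _ q2.
rewrite /= in a1 a2 a3 a4; apply: inter; rewrite -?natr1 ?mE.
- by clear - a1 v2 p1 rho1; lra.
- by clear - a2 v1 p2 m1; lra.
- by clear - a3 v4 p3 rho1; lra.
- by clear - a4 v3 p4 m1; lra.
Qed.

End Discretise.

Theorem planar_has_dual (R : realType) (T : finType) (E : {set {set T}}) :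
  simple_graph E -> planar R E -> has_dual E.
Proof.
move=> sE [pos [arc drawing]].
have [->|/finset.set0Pn[f fE]] := eqVneq E finset.set0; first exact: has_dual0.
have /card_gt0P[x0 _] : (0 < #|f|)%N by rewrite sE.
have [m [rho [c [src [tgt [W [K gd]]]]]]] := planar_grid_drawing x0 sE drawing.
exact: grid_drawing_dual gd.
Qed.

(** * The bound on the planar Turan number of the pentagon *)

Lemma planar_sub (R : realType) (T : finType) (E E' : {set {set T}}) :
  E' \subset E -> planar R E -> planar R E'.
Proof.
move=> /fintype.subsetP EE [pos [arc [h1 h2 h3 h4]]]; exists pos, arc; split=> //.
- by move=> x y /EE; exact: h2.
- by move=> f z /EE; exact: h3.
- by move=> f g /EE fE /EE; exact: h4.
Qed.

Lemma C5_free_of_is_free (T : finType) (E : {set {set T}}) :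
  is_free (cycle_graph 5) E -> C5_free E.
Proof.
move=> free x y z a b U xy yz za ab bx; apply: free.
pose t := [tuple x; y; z; a; b].
exists (tnth t); first exact/tuple_uniqP.
move=> _ /imsetP[i _ ->]; rewrite imsetU1 imset_set1 !(tnth_nth x) /=.
by case: i => -[|[|[|[|[|//]]]]].
Qed.

Theorem theorem8 (R : realType) (n : nat) (hn : (11 <= n)%N) :
  ((ex_planar R n (cycle_graph 5))%:R : R) <= (12 * n%:R - 33) / 5.
Proof.
suff h : (5 * ex_planar R n (cycle_graph 5) + 33 <= 12 * n)%N.
  by move: h; rewrite -(ler_nat R) natrD !natrM => h; lra.
suff : (ex_planar R n (cycle_graph 5) <= (12 * n - 33) %/ 5)%N.
  move: (ex_planar _ _ _) => k; rewrite leq_divRL // => h.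
  by move: h hn; clear; lia.
apply/bigmax_leqP => E /asboolP[sE pE fE]; rewrite leq_divRL //.
have EV f : f \in E -> f \subset [set: 'I_n]%SET by rewrite finset.subsetT.
have bound : C5_bound [set: 'I_n]%SET E.
  apply: planar_C5_bound => //.
  - exact: C5_free_of_is_free.
  - move=> E' sub; apply: (@planar_has_dual R); first exact: sub_simple sub sE.
    exact: planar_sub sub pE.
  - by rewrite cardsT card_ord (leq_trans _ hn).
have := C5_bound_large _ bound; rewrite cardsT card_ord => /(_ hn).
by move: #|E| => e; clear; lia.
Qed.
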